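(* Let $G^{\alpha}=\langle X\mid R\rangle$ be a presentation, with finite generating set $X$, of a group $G$. Let $G_1$ be a normal subgroup of $G$ and let $G_2=G/G_1$ with the presentation $G_2^{\alpha_2}$ induced by $G^{\alpha}$. Then $$\hat\Xi(G^{\alpha})\le \hat\Xi(G_2^{\alpha_2})-\left(\frac{1}{|G_2|}-\frac{1}{|G|}\right),$$ with equality holding if $G_1$ is amenable.
   Context: Conventions: $1/|K|$ is defined to be $0$ if the group $K$ is infinite. The induced presentation $G_2^{\alpha_2}$ of the factor group $G_2=G/G_1$ has the same generating symbols $X$ as $G^{\alpha}$, each $x\in X$ representing its image in $G_2$, and all relations of $G^{\alpha}$ hold in it. For a presentation $K^{\kappa}=\langle X\mid R\rangle$ of a group $K$, $X=\{x_1,\dots,x_n\}$ finite (generators are regarded as distinct symbols, although different symbols may represent the same element of $K$ and a symbol may represent the identity), the associated Cayley graph $\Gamma$ has vertex set $K$ and, for every $g\in K$ and every $j$, exactly one edge from $g$ to $gx_j$, labelled $x_j$ (loops and multiple edges are allowed). For a non-empty finite subgraph $\Gamma'$ of $\Gamma$ let $\beta_0(\Gamma')$ be its number of vertices, let $\beta_2(\Gamma')$ be its cyclomatic number, i.e. the sum over its connected components of the rank of the fundamental group of the component, and let $\xi(\Gamma')=\beta_2(\Gamma')/\beta_0(\Gamma')$. An exhausting chain is a sequence $\Gamma_1\subseteq\Gamma_2\subseteq\cdots$ of finite connected subgraphs of $\Gamma$ whose union is $\Gamma$. The cyclomatic quotient is $$\Xi(K^{\kappa})=\sup\limsup_{i\to\infty}\xi(\Gamma_i),$$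 the supremum being over all exhausting chains; equivalently, $\Xi(K^{\kappa})=\sup\xi(\Gamma')$ over all non-empty finite subgraphs $\Gamma'$ of $\Gamma$. The normalized cyclomatic quotient is $\hat\Xi(K^{\kappa})=1-n+\Xi(K^{\kappa})$. *)

(* Defs.v *)
From HB Require Import structures.
From mathcomp Require Import all_boot all_order all_algebra.
From mathcomp Require Import finmap generic_quotient.
From mathcomp Require Import all_classical all_reals all_analysis.

Set Implicit Arguments.
Unset Strict Implicit.
Unset Printing Implicit Defensive.

Import Order.TTheory GRing.Theory Num.Theory.

Local Open Scope classical_set_scope.
Local Open Scope fset_scope.
Local Open Scope group_scope.

Section Subgroup.
Variables (G : groupType) (H : groupClosed G).

Definition subgroup_of := {g : G | g \in H}.

HB.instance Definition _ := Choice.on subgroup_of.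
HB.instance Definition _ := SubType.on subgroup_of.

Fact subgroup_of_closed : group_closed [pred g : G | g \in H].
Proof.
split=> [|g h gH hH]; first by rewrite inE gpred1.
by rewrite inE gpredF.
Qed.

HB.instance Definition _ :=
  SubChoice_isSubGroup.Build G (fun g : G => g \in H) subgroup_of
    subgroup_of_closed.

End Subgroup.

Definition is_normal (G : groupType) (N : groupClosed G) : Prop :=
  forall g h : G, h \in N -> h ^ g \in N.

Section Quotient.
Variables (G : groupType) (N : groupClosed G).

Definition coset_rel (g h : G) : bool := g^-1 * h \in N.

Fact coset_rel_refl : reflexive coset_rel.
Proof. by move=> g; rewrite /coset_rel mulVg gpred1. Qed.

Fact coset_rel_sym : symmetric coset_rel.
Proof.
by move=> g h; rewrite /coset_rel -(gpredV N (h^-1 * g)) invgM invgK.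
Qed.

Fact coset_rel_trans : transitive coset_rel.
Proof.
move=> h g k gh hk.
by rewrite /coset_rel -(mulVKg h k) mulgA gpredM.
Qed.

Canonical coset_equiv :=
  EquivRel coset_rel coset_rel_refl coset_rel_sym coset_rel_trans.

(* The argument of type [is_normal N] is a phantom: it lets the group structure
   below be inferred from the type. *)
Definition quotient_group of is_normal N := {eq_quot coset_rel}%qT.

Hypothesis nN : is_normal N.
Local Notation Q := (quotient_group nN).

HB.instance Definition _ := Choice.on Q.
HB.instance Definition _ := EqQuotient.on Q.

Definition quotient_proj (g : G) : Q := (\pi g)%qT.

Definition quotient_one : Q := quotient_proj 1.
Definition quotient_inv (a : Q) : Q := quotient_proj (repr a)^-1.
Definition quotient_mul (a b : Q) : Q := quotient_proj (repr a * repr b).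

Lemma quotient_proj_eq (g h : G) :
  (quotient_proj g == quotient_proj h) = (g^-1 * h \in N).
Proof. exact: (eqmodE coset_equiv). Qed.

Lemma quotient_projP (a : Q) : quotient_proj (repr a) = a.
Proof. exact: reprK. Qed.

Lemma quotient_projM (g h : G) :
  quotient_mul (quotient_proj g) (quotient_proj h) = quotient_proj (g * h).
Proof.
apply/eqP; rewrite quotient_proj_eq.
set r := repr _; set s := repr _.
have rg : r^-1 * g \in N.
  by rewrite -quotient_proj_eq quotient_projP.
have sh : s^-1 * h \in N.
  by rewrite -quotient_proj_eq quotient_projP.
have -> : (r * s)^-1 * (g * h) = s^-1 * h * (r^-1 * g) ^ h.
  by rewrite invgM conjgE !mulgA mulgK.
by rewrite gpredM // nN.
Qed.

Lemma quotient_projV (g : G) :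
  quotient_inv (quotient_proj g) = quotient_proj g^-1.
Proof.
apply/eqP; rewrite quotient_proj_eq invgK.
set r := repr _.
have rg : r^-1 * g \in N.
  by rewrite -quotient_proj_eq quotient_projP.
have -> : r * g^-1 = ((r^-1 * g) ^ r^-1)^-1.
  by rewrite conjgE invgK mulgA mulgA mulgV mul1g invgM invgK.
by rewrite gpredV nN.
Qed.

Fact quotient_mulA : associative quotient_mul.
Proof.
move=> a b c; rewrite -(quotient_projP a) -(quotient_projP b).
by rewrite -(quotient_projP c) !quotient_projM mulgA.
Qed.

Fact quotient_mul1 : left_id quotient_one quotient_mul.
Proof. by move=> a; rewrite -(quotient_projP a) quotient_projM mul1g. Qed.

Fact quotient_1mul : right_id quotient_one quotient_mul.
Proof. by move=> a; rewrite -(quotient_projP a) quotient_projM mulg1. Qed.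

Fact quotient_mulV : left_inverse quotient_one quotient_inv quotient_mul.
Proof.
by move=> a; rewrite -(quotient_projP a) quotient_projV quotient_projM mulVg.
Qed.

Fact quotient_Vmul : right_inverse quotient_one quotient_inv quotient_mul.
Proof.
by move=> a; rewrite -(quotient_projP a) quotient_projV quotient_projM mulgV.
Qed.

HB.instance Definition _ := isGroup.Build Q quotient_mulA quotient_mul1
  quotient_1mul quotient_mulV quotient_Vmul.

End Quotient.

Section Presentation.
Variable n : nat.

(* The letter (j, true) is the symbol x_j, and (j, false) its formal inverse. *)
Definition word := seq ('I_n * bool).

Definition eval_word (G : groupType) (x : 'I_n -> G) (w : word) : G :=
  \prod_(l <- w) (if l.2 then x l.1 else (x l.1)^-1).

(* Equality of words in the group < X | rels >. *)
Inductive eq_modulo (rels : set word) : word -> word -> Prop :=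
| eq_modulo_refl w : eq_modulo rels w w
| eq_modulo_sym w1 w2 : eq_modulo rels w1 w2 -> eq_modulo rels w2 w1
| eq_modulo_trans w1 w2 w3 :
    eq_modulo rels w1 w2 -> eq_modulo rels w2 w3 -> eq_modulo rels w1 w3
| eq_modulo_cancel w1 w2 (j : 'I_n) (b : bool) :
    eq_modulo rels (w1 ++ [:: (j, b), (j, ~~ b) & w2]) (w1 ++ w2)
| eq_modulo_relator w1 r w2 :
    rels r -> eq_modulo rels (w1 ++ r ++ w2) (w1 ++ w2).

Record presentation (G : groupType) := Presentation {
  gens : 'I_n -> G;
  relators : set word;
  gens_generate : forall g : G, exists w : word, eval_word gens w = g;
  relators_hold : forall r : word, relators r -> eval_word gens r = 1;
  relators_suffice :
    forall w : word, eval_word gens w = 1 -> eq_modulo relators w [::]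
}.

Section Induced.
Variables (G : groupType) (P : presentation G) (N : groupClosed G).
Hypothesis nN : is_normal N.

Definition induced_gens (j : 'I_n) : quotient_group nN :=
  quotient_proj nN (gens P j).

Definition induced_relators : set word := [set w | eval_word (gens P) w \in N].

Lemma eval_word_induced (w : word) :
  eval_word induced_gens w = quotient_proj nN (eval_word (gens P) w).
Proof.
rewrite /eval_word; elim: w => [|[j b] w IHw]; first by rewrite !big_nil.
rewrite !big_cons IHw -quotient_projM; congr (_ * _).
by case: b => //=; rewrite -quotient_projV.
Qed.

Lemma induced_relatorsE (w : word) :
  induced_relators w <-> eval_word induced_gens w = 1.
Proof.
rewrite eval_word_induced /induced_relators /=; split=> [wN|/eqP].
- by apply/eqP; rewrite eq_sym quotient_proj_eq invg1 mul1g.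
- by rewrite eq_sym quotient_proj_eq invg1 mul1g.
Qed.

Fact induced_generate (a : quotient_group nN) :
  exists w : word, eval_word induced_gens w = a.
Proof.
have [w wE] := gens_generate P (repr a).
by exists w; rewrite eval_word_induced wE quotient_projP.
Qed.

Fact induced_relators_suffice (w : word) :
  eval_word induced_gens w = 1 -> eq_modulo induced_relators w [::].
Proof.
move=> /induced_relatorsE wN.
by have := eq_modulo_relator [::] [::] wN; rewrite /= cats0.
Qed.

(* The relators are all words in X that are trivial in G / N: in particular
   they include those of P (see [induced_relators_sub]). *)
Definition induced_presentation : presentation (quotient_group nN) :=
  Presentation induced_generate (fun w => (induced_relatorsE w).1)
    induced_relators_suffice.

Lemma induced_relators_sub :
  (relators P `<=` relators induced_presentation)%classic.
Proof.
by move=> r rP; rewrite /= /induced_relators /= relators_hold ?gpred1.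
Qed.

End Induced.
End Presentation.

Section Cayley.
Variables (K : groupType) (n : nat) (x : 'I_n -> K).

(* The edge (g, j) goes from g to g * x j and is labelled j: edges with the
   same ends and different labels are distinct. *)
Definition cayley_edge := (K * 'I_n)%type.
Definition edge_source (e : cayley_edge) : K := e.1.
Definition edge_target (e : cayley_edge) : K := e.1 * x e.2.

Record subgraph := Subgraph {
  vertices : {fset K};
  edges : {fset cayley_edge};
  edges_incident : forall e, e \in edges ->
    (edge_source e \in vertices) /\ (edge_target e \in vertices)
}.

Definition subgraph_le (A B : subgraph) : Prop :=
  vertices A `<=` vertices B /\ edges A `<=` edges B.

(* A dart is an edge with a direction of travel: along the edge for true,
   against it for false. A loop carries two darts, inverse to each other. *)
Definition dart := (cayley_edge * bool)%type.
Definition dart_start (d : dart) : K :=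
  if d.2 then edge_source d.1 else edge_target d.1.
Definition dart_end (d : dart) : K :=
  if d.2 then edge_target d.1 else edge_source d.1.
Definition dart_inv (d : dart) : dart := (d.1, ~~ d.2).

Fixpoint walk (A : subgraph) (u : K) (p : seq dart) (v : K) : bool :=
  if p is d :: q then
    [&& d.1 \in edges A, dart_start d == u & walk A (dart_end d) q v]
  else u == v.

Definition walk_inv (p : seq dart) : seq dart := rev (map dart_inv p).

Definition reachable (A : subgraph) (u v : K) : Prop :=
  exists p, walk A u p v.

Definition connected_subgraph (A : subgraph) : Prop :=
  vertices A != fset0 /\
  forall u v, u \in vertices A -> v \in vertices A -> reachable A u v.

Inductive homotopic (A : subgraph) (u v : K) : seq dart -> seq dart -> Prop :=
| homotopic_refl p : homotopic A u v p p
| homotopic_sym p q : homotopic A u v p q -> homotopic A u v q p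
| homotopic_trans p q r :
    homotopic A u v p q -> homotopic A u v q r -> homotopic A u v p r
| homotopic_spur p d q :
    walk A u (p ++ [:: d, dart_inv d & q]) v ->
    homotopic A u v (p ++ [:: d, dart_inv d & q]) (p ++ q).

(* The classes of the closed walks in s generate the fundamental group of A
   based at u. *)
Definition generates_pi1 (A : subgraph) (u : K) (s : seq (seq dart)) : Prop :=
  (forall p, p \in s -> walk A u p u) /\
  (forall p, walk A u p u -> exists w : seq (seq dart),
     (forall q, q \in w -> (q \in s) || (walk_inv q \in s)) /\
     homotopic A u u p (flatten w)).

(* The least size of a generating family; one exists since A is finite. *)
Definition pi1_rank (A : subgraph) (u : K) : nat :=
  xget 0%N [set k : nat |
    (exists2 s, generates_pi1 A u s & size s = k) /\
    (forall s, generates_pi1 A u s -> (k <= size s)%N)].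

Definition component (A : subgraph) (u : K) : {fset K} :=
  [fset v in vertices A | `[< reachable A u v >]].

Definition components (A : subgraph) : {fset {fset K}} :=
  [fset component A u | u in vertices A].

(* Any vertex of a component will do, up to isomorphism of fundamental groups;
   the default value is never used as components are non-empty. *)
Definition base_vertex (C : {fset K}) : K := head 1 (enum_fset C).

Definition beta0 (A : subgraph) : nat := #|` vertices A|.

Definition beta2 (A : subgraph) : nat :=
  (\sum_(C <- components A) pi1_rank A (base_vertex C))%N.

Definition exhausting_chain (A : nat -> subgraph) : Prop :=
  [/\ forall i, connected_subgraph (A i),
      forall i, subgraph_le (A i) (A i.+1),
      forall g, exists i, g \in vertices (A i)
    & forall e, exists i, e \in edges (A i)].

Variable R : realType.

Definition xi (A : subgraph) : R := ((beta2 A)%:R / (beta0 A)%:R)%R.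

Definition cyclomatic_quotient_of : \bar R :=
  ereal_sup [set limn_esup (fun i => (xi (A i))%:E) | A in exhausting_chain].

End Cayley.

Section NormalizedCyclomaticQuotient.
Variables (R : realType) (n : nat) (K : groupType) (P : presentation n K).

Definition cyclomatic_quotient : \bar R := cyclomatic_quotient_of (gens P) R.

Definition normalized_cyclomatic_quotient : \bar R :=
  ((1 - n%:R)%:E + cyclomatic_quotient)%E.

End NormalizedCyclomaticQuotient.

Definition inv_card (R : realType) (K : groupType) : R :=
  if `[< finite_set [set: K] >] then ((#|` fset_set [set: K]|)%:R^-1)%R else 0%R.

(* Existence of a left-invariant finitely additive probability measure defined
   on all subsets of H. *)
Definition amenable (R : realType) (H : groupType) : Prop :=
  exists mu : set H -> R,
    [/\ forall A, (0 <= mu A)%R,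
        mu [set: H] = 1%R,
        forall A B, (A `&` B = set0)%classic -> mu (A `|` B)%classic = (mu A + mu B)%R
      & forall h A, mu [set h * a | a in A] = mu A].

(* Main.v *)
Require Import Defs.
From mathcomp Require Import all_boot all_order all_algebra.
From mathcomp Require Import finmap lra.
From mathcomp Require Import all_classical all_reals all_analysis.

Set Implicit Arguments.
Unset Strict Implicit.
Unset Printing Implicit Defensive.

Import Order.TTheory GRing.Theory Num.Theory.

(** For a finite set S of group elements let its boundary be the number of edges
    of the Cayley graph that leave S, and let h(K) be the infimum of
    boundary(S) / |S| over the non-empty finite S. The theorem follows from

      normalized cyclomatic quotient of K = 1/|K| - h(K)       (1)

    ([normalized_cyclomatic_quotientE]) together with h(G/N) <= h(G)
    ([isoperimetric_projection]) and, for amenable N, h(G) <= h(G/N)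
    ([isoperimetric_amenable]).

    Proof of (1). By Euler's formula [beta2_connected], a connected subgraph
    spanned by S has 1 - n + xi = (1 - boundary(S)) / |S|. If K is finite, S = K is
    optimal. If K is infinite, the 1 in the numerator has to be shown harmless: any
    ratio (1 - boundary(S)) / |S| that occurs also occurs, up to improvement, on
    arbitrarily large connected sets ([large_connected]). Indeed, an optimal
    connected set A among those with at most M elements has a translate that
    contains the far end of an edge leaving A. The union of A and this translate
    is again optimal, by submodularity of the boundary if they meet and by the
    joining edge if they are disjoint, so a largest optimal A would be exceeded.
    Adding such large sets to growing neighbourhoods of 1 gives the exhausting
    chains ([chain_infinite]).

    Proof of h(G/N) <= h(G). A set S in G is pushed forward to the function
    q |-> |S meets the coset q| on G/N, and a non-negative function satisfies the
    isoperimetric inequality because it is a positive combination of indicator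
    functions of its level sets ([layer_cake]).

    Proof of h(G) <= h(G/N) for amenable N. By duality the isoperimetric
    inequality in G is witnessed by a flow: weights in [0, 1] on the edges whose
    net outflow at each vertex is at least h(G) ([isoperimetric_flow]). The duality
    is a Hahn-Banach argument in the form of the Mazur-Orlicz theorem
    ([mazur_orlicz]), and [layer_cake] is its hypothesis. Averaging the flow over
    the cosets of N gives a flow on G/N with the same lower bound, and summing
    the net outflow over a finite set T of G/N bounds h(G) |T| by the boundary
    of T. *)

(** * Walks and homotopy *)
Section Walks.
Variables (K : groupType) (n : nat) (x : 'I_n -> K) (A : subgraph x).
Local Open Scope fset_scope.

Implicit Types (u v w : K) (p q r : seq (dart K n)) (d : dart K n).

(** The vertex at which the dart sequence p, started at u, ends: u itself if p is
    empty. *)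
Definition walk_end u p : K := foldl (fun _ d => dart_end x d) u p.

Lemma dart_start_inv d : dart_start x (dart_inv d) = dart_end x d.
Proof. by case: d => e []. Qed.

Lemma dart_end_inv d : dart_end x (dart_inv d) = dart_start x d.
Proof. by case: d => e []. Qed.

Lemma dart_invK : involutive (@dart_inv K n).
Proof. by case=> e []. Qed.

Lemma walk_invK : involutive (@walk_inv K n).
Proof.
move=> p; rewrite /walk_inv map_rev revK -map_comp map_id_in// => d _ /=.
exact: dart_invK.
Qed.

Lemma walk_inv_cons d p : walk_inv (d :: p) = rcons (walk_inv p) (dart_inv d).
Proof. by rewrite /walk_inv /= rev_cons. Qed.

Lemma walk_inv_cat p q : walk_inv (p ++ q) = walk_inv q ++ walk_inv p.
Proof. by rewrite /walk_inv map_cat rev_cat. Qed.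

Lemma walk_walk_end u p v : walk A u p v -> v = walk_end u p.
Proof. by elim: p u => [|d p IHp] u /=; [move/eqP|case/and3P=> _ _ /IHp]. Qed.

Lemma walk_cat u p q w :
  walk A u (p ++ q) w = walk A u p (walk_end u p) && walk A (walk_end u p) q w.
Proof. by elim: p u => [|d p IHp] u /=; rewrite ?eqxx// IHp -!andbA. Qed.

Lemma walk_concat u p v q w : walk A u p v -> walk A v q w -> walk A u (p ++ q) w.
Proof. by move=> up; rewrite walk_cat -(walk_walk_end up) up. Qed.

Lemma walk_inverse u p v : walk A u p v -> walk A v (walk_inv p) u.
Proof.
elim: p u => [|d p IHp] u /=; first by rewrite eq_sym.
case/and3P=> dA /eqP <- /IHp pv; rewrite walk_inv_cons -cats1.
apply: walk_concat pv _ => /=.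
by rewrite dA dart_start_inv dart_end_inv !eqxx.
Qed.

Lemma dart_vertices d : d.1 \in edges A ->
  (dart_start x d \in vertices A) /\ (dart_end x d \in vertices A).
Proof. by case: d => e [] /= /edges_incident[]. Qed.

Lemma walk_vertex u p v : walk A u p v -> u \in vertices A -> v \in vertices A.
Proof.
elim: p u => [|d p IHp] u /=; first by move/eqP->.
by case/and3P=> /dart_vertices[_ dA] _ /IHp pv _; exact: pv.
Qed.

Lemma homotopic_walk u v p q : homotopic A u v p q -> walk A u p v = walk A u q v.
Proof.
elim=> {p q} [//|p q _ //|p q r _ -> _ -> //|p d q pdq]; rewrite pdq; apply/esym.
move: pdq; rewrite !walk_cat /= => /and3P[-> _ /and4P[/eqP + _ _]].
by rewrite dart_end_inv => ->.
Qed.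

Lemma homotopic_cat a u v b p q r s : walk A a r u -> walk A v s b ->
  homotopic A u v p q -> homotopic A a b (r ++ p ++ s) (r ++ q ++ s).
Proof.
move=> ar vs; elim=> {p q} [p|p q _|p q t _ pq _ qt|p d q pdq].
- exact: homotopic_refl.
- exact: homotopic_sym.
- exact: homotopic_trans pq qt.
- rewrite -!catA /= catA (catA r p).
  apply: homotopic_spur; rewrite -catA.
  apply: walk_concat ar _; rewrite -2!cat_cons catA.
  exact: walk_concat vs.
Qed.

Lemma homotopic_catl a u v p q r : walk A a r u ->
  homotopic A u v p q -> homotopic A a v (r ++ p) (r ++ q).
Proof.
move=> ar pq; have := @homotopic_cat a u v v p q r [::] ar (eqxx v) pq.
by rewrite !cats0.
Qed.

Lemma homotopic_catr u v b p q s : walk A v s b ->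
  homotopic A u v p q -> homotopic A u b (p ++ s) (q ++ s).
Proof. by move=> vs pq; exact: (@homotopic_cat u u v b p q [::] s (eqxx u) vs pq). Qed.

Lemma homotopic_cat2 u v w p p' q q' :
  walk A u p' v -> walk A v q w ->
  homotopic A u v p p' -> homotopic A v w q q' ->
  homotopic A u w (p ++ q) (p' ++ q').
Proof.
move=> up' vq pp' qq'; apply: homotopic_trans (homotopic_catr vq pp') _.
exact: homotopic_catl qq'.
Qed.

Lemma homotopic_inv u v p : walk A u p v -> homotopic A u u (p ++ walk_inv p) [::].
Proof.
elim: p u => [|d p IHp] u /=; first by move=> _; exact: homotopic_refl.
case/and3P=> dA /eqP du pv; rewrite walk_inv_cons -cats1 catA.
apply: (@homotopic_trans _ _ _ _ _ _ _ ([:: d] ++ [::] ++ [:: dart_inv d])).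
  rewrite -cat1s.
  apply: (@homotopic_cat _ (dart_end x d) (dart_end x d)); last exact: IHp pv.
  - by rewrite /= dA du !eqxx.
  - by rewrite /= dA dart_start_inv dart_end_inv du !eqxx.
apply: (@homotopic_spur _ _ _ _ _ _ [::] d [::]).
by rewrite /= dA dart_start_inv dart_end_inv du !eqxx.
Qed.

End Walks.

(** * Spanning trees *)
Section SpanningTree.
Variables (K : groupType) (n : nat) (x : 'I_n -> K) (A : subgraph x).
Local Open Scope fset_scope.

(** A tree in A rooted at u, with vertex set W and edge set T, is given by a walk
    t v from the root to each vertex v of W. The last field says that each tree
    edge extends the walk to one of its ends to the walk to the other end, so t v
    is the tree path. Acyclicity is encoded by the cardinality of T. *)
Record spanning_tree (u : K) (W : {fset K}) (T : {fset cayley_edge K n})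
    (t : K -> seq (dart K n)) : Prop := SpanningTree {
  tree_root : u \in W;
  tree_vertices : W `<=` vertices A;
  tree_edges : T `<=` edges A;
  tree_card : #|` T|.+1 = #|` W|;
  tree_nil : t u = [::];
  tree_walk : forall v, v \in W -> walk A u (t v) v;
  tree_walk_edges : forall v d, v \in W -> d \in t v -> d.1 \in T;
  tree_ends : forall e, e \in T -> (edge_source e \in W) /\ (edge_target x e \in W);
  tree_step : forall e, e \in T ->
    t (edge_target x e) = rcons (t (edge_source e)) (e, true) \/
    t (edge_source e) = rcons (t (edge_target x e)) (e, false)
}.

(** A walk that starts in W and ends outside W leaves W along some dart. *)
Lemma exit_dart (W : {fset K}) a p b : walk A a p b -> a \in W -> b \notin W ->
  exists d : dart K n, [/\ d.1 \in edges A, dart_start x d \in W & dart_end x d \notin W].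
Proof.
elim: p a => [|d p IHp] a /=; first by move/eqP-> => ->.
case/and3P=> dA /eqP <- pb dW bW.
have [eW|eW] := boolP (dart_end x d \in W); first exact: IHp pb eW bW.
by exists d.
Qed.

Lemma tree_extend u W T t : connected_subgraph A -> spanning_tree u W T t ->
  W != vertices A ->
  exists (W' : {fset K}) T' t', #|` W'| = #|` W|.+1 /\ spanning_tree u W' T' t'.
Proof.
move=> [_ Ac] [uW WV TE TW tu tw te tends tst] WA.
have [v vA vW] : exists2 v, v \in vertices A & v \notin W.
  have : ~~ (vertices A `<=` W).
    by apply: contra WA => AW; rewrite eqEfsubset WV.
  by case/fsubsetPn => v; exists v.
have [p pv] := Ac _ _ (fsubsetP WV _ uW) vA.
have [d [dA dW eW]] := exit_dart pv uW vW.
have [sV eV] := dart_vertices dA.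
set a := dart_start x d in dW sV *; set b := dart_end x d in eW eV *.
have dT : d.1 \notin T.
  apply/negP => /tends[]; rewrite /b /dart_end in eW.
  by move: eW; case: d.2 => /negP.
pose t' w := if w == b then rcons (t a) d else t w.
have tE w : w \in W -> t' w = t w.
  by rewrite /t'; case: eqP => // ->; rewrite (negbTE eW).
exists (b |` W), (d.1 |` T), t'; split; first by rewrite cardfsU1 eW.
split.
- by rewrite !inE uW orbT.
- by rewrite fsubUset WV fsub1set eV.
- by rewrite fsubUset TE fsub1set dA.
- by rewrite !cardfsU1 dT eW -TW.
- by rewrite tE.
- move=> w; rewrite !inE => /orP[/eqP->|wW]; last by rewrite tE ?tw.
  rewrite /t' eqxx -cats1; apply: walk_concat (tw _ dW) _.
  by rewrite /= dA /a /b !eqxx.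
- move=> w f; rewrite !inE => /orP[/eqP->|wW].
    rewrite /t' eqxx mem_rcons inE => /orP[/eqP->|]; first by rewrite eqxx.
    by move/(te _ _ dW) => ->; rewrite orbT.
  by rewrite tE// => /(te _ _ wW) ->; rewrite orbT.
- move=> e; rewrite !inE => /orP[/eqP->|/tends[-> ->]]; last by rewrite !orbT.
  move: dW; rewrite /a /b /dart_start /dart_end.
  by case: d.2 => ->; rewrite eqxx orbT.
- move=> e; rewrite !inE => /orP[/eqP->|eT]; last first.
    by have [sW eW'] := tends _ eT; rewrite !tE//; exact: tst.
  clear dT tE; rewrite /t' /a /b /dart_start /dart_end in dW eW *.
  case: d dA dW eW {sV eV a b t'} => e' [] /= _ dW eW; [left|right].
    by rewrite eqxx; case: eqP => // E; rewrite -E dW in eW.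
  by rewrite eqxx; case: eqP => // E; rewrite -E dW in eW.
Qed.

Lemma spanning_tree_exists u : connected_subgraph A -> u \in vertices A ->
  exists T t, spanning_tree u (vertices A) T t.
Proof.
move=> Ac uA.
have H k : (k < #|` vertices A|)%N ->
    exists (W : {fset K}) T t, #|` W| = k.+1 /\ spanning_tree u W T t.
  elim: k => [_|k IHk kV].
    exists [fset u], fset0, (fun=> [::]); rewrite cardfs1; split=> //; split=> //.
    - by rewrite inE.
    - by rewrite fsub1set.
    - by rewrite cardfs0 cardfs1.
    - by move=> v; rewrite inE => /eqP-> /=.
  have [W [T [t [Wk Wt]]]] := IHk (ltnW kV).
  have WA : W != vertices A by apply: contraTneq kV => <-; rewrite Wk ltnn.
  by rewrite -Wk; exact: tree_extend Wt WA.
have V0 : (0 < #|` vertices A|)%N by rewrite cardfs_gt0; case: Ac.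
have [|W [T [t [Wk Wt]]]] := H (#|` vertices A|.-1); first by rewrite prednK.
suff <- : W = vertices A by exists T, t.
by apply/eqP; rewrite eqEfcard (tree_vertices Wt) Wk prednK// leqnn andbT.
Qed.

End SpanningTree.

(** * Generators of the fundamental group *)
Section CyclomaticNumber.
Variables (K : groupType) (n : nat) (x : 'I_n -> K) (A : subgraph x).
Variables (u : K) (T : {fset cayley_edge K n}) (t : K -> seq (dart K n)).
Hypothesis tT : spanning_tree A u (vertices A) T t.
Local Open Scope fset_scope.

(** The edges of A outside the spanning tree. *)
Definition chords : {fset cayley_edge K n} := edges A `\` T.

(** The closed walk at the root that follows the tree to the source of e, crosses
    e, and returns along the tree. *)
Definition chord_loop (e : cayley_edge K n) : seq (dart K n) :=
  t (edge_source e) ++ (e, true) :: walk_inv (t (edge_target x e)).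

Definition chord_loops := map chord_loop (enum_fset chords).

Lemma card_chords : (#|` chords| + #|` vertices A| = #|` edges A| + 1)%N.
Proof.
by rewrite -(tree_card tT) addn1 addnS addnC cardfsDS ?(tree_edges tT)// subnKC//
  fsubset_leq_card// (tree_edges tT).
Qed.

Lemma chord_loop_closed e : e \in chords -> walk A u (chord_loop e) u.
Proof.
rewrite inE => /andP[_ eA]; have [sA tA] := edges_incident eA.
apply: walk_concat (tree_walk tT sA) _ => /=.
rewrite eA /= /dart_start /dart_end /= eqxx /=.
exact: walk_inverse (tree_walk tT tA).
Qed.

(** The loop that a dart closes with the tree is, up to homotopy, trivial for a
    tree edge and otherwise a chord loop or the inverse of one. *)
Lemma tree_dart_loop a d : d.1 \in edges A -> dart_start x d = a ->
  exists w : seq (seq (dart K n)),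
    (forall q, q \in w -> (q \in chord_loops) || (walk_inv q \in chord_loops)) /\
    homotopic A u u (t a ++ d :: walk_inv (t (dart_end x d))) (flatten w).
Proof.
move=> dA <-{a}; have [sA eA] := dart_vertices dA.
have [dT|dT] := boolP (d.1 \in T); last first.
  have dC : d.1 \in chords by rewrite inE dT.
  exists [:: t (dart_start x d) ++ d :: walk_inv (t (dart_end x d))]; split; last first.
    by rewrite /= cats0; exact: homotopic_refl.
  move=> q; rewrite inE => /eqP->{q}.
  case: d {dA sA eA dT} dC => e [] /= eC; apply/orP; [left|right].
    by apply/mapP; exists e.
  apply/mapP; exists e => //; rewrite walk_inv_cat walk_inv_cons walk_invK.
  by rewrite /chord_loop /dart_start /dart_end /= cat_rcons.
exists [::]; split=> //=.
have H : t (dart_end x d) = rcons (t (dart_start x d)) d \/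
         t (dart_start x d) = rcons (t (dart_end x d)) (dart_inv d).
  case: d dT {dA sA eA} => e [] /= /(tree_step tT)[];
    rewrite /dart_start /dart_end /dart_inv /=; by [left|right].
case: H => H.
  rewrite -cat_rcons -H; exact: homotopic_inv (tree_walk tT eA).
rewrite H cat_rcons.
apply: homotopic_trans (homotopic_inv (tree_walk tT eA)).
have := @homotopic_spur _ _ _ A u u (t (dart_end x d)) (dart_inv d)
  (walk_inv (t (dart_end x d))).
rewrite dart_invK; apply.
apply: walk_concat (tree_walk tT eA) _ => /=.
rewrite dA /= dart_start_inv dart_end_inv !eqxx /=.
exact: walk_inverse (tree_walk tT eA).
Qed.

(** Inserting a return to the root after each dart writes a walk as a product of
    loops closed by single darts. *)
Lemma tree_walk_loops a p b : walk A a p b -> a \in vertices A ->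
  exists w : seq (seq (dart K n)),
    (forall q, q \in w -> (q \in chord_loops) || (walk_inv q \in chord_loops)) /\
    homotopic A u u (t a ++ p ++ walk_inv (t b)) (flatten w).
Proof.
elim: p a => [|d p IHp] a /=.
  move/eqP-> => bA; exists [::]; split=> //=.
  exact: homotopic_inv (tree_walk tT bA).
case/and3P=> dA /eqP da pb aA.
have [_ cA] := dart_vertices dA.
have [w2 [w2s w2h]] := IHp _ pb cA.
have [w1 [w1s w1h]] := tree_dart_loop dA da.
have bA := walk_vertex pb cA.
(* a return trip to the root is inserted after d *)
have wac : walk A u (t a ++ [:: d]) (dart_end x d).
  by apply: walk_concat (tree_walk tT aA) _; rewrite /= dA da !eqxx.
have wc := walk_inverse (tree_walk tT cA).
have wcb : walk A (dart_end x d) (p ++ walk_inv (t b)) u.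
  exact: walk_concat pb (walk_inverse (tree_walk tT bA)).
exists (w1 ++ w2); split.
  by move=> q; rewrite mem_cat => /orP[/w1s|/w2s].
rewrite flatten_cat; apply: homotopic_trans; last first.
  apply: (homotopic_cat2 _ _ w1h w2h).
  - rewrite -(homotopic_walk w1h) -cat1s catA; exact: walk_concat wac wc.
  - exact: walk_concat (tree_walk tT cA) wcb.
apply: homotopic_sym; set c := dart_end x d in wc wac wcb cA *.
have -> : (t a ++ d :: walk_inv (t c)) ++ t c ++ p ++ walk_inv (t b) =
    (t a ++ [:: d]) ++ (walk_inv (t c) ++ t c) ++ p ++ walk_inv (t b).
  by rewrite -!catA.
have -> : t a ++ d :: p ++ walk_inv (t b) = (t a ++ [:: d]) ++ [::] ++ p ++ walk_inv (t b).
  by rewrite -!catA.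
apply: homotopic_cat wac wcb _.
by have := homotopic_inv wc; rewrite walk_invK.
Qed.

Lemma chord_loops_generate : generates_pi1 A u chord_loops.
Proof.
split=> [p /mapP[e eC ->]|p pu]; first exact: chord_loop_closed.
have [w [ws wh]] := tree_walk_loops pu (tree_root tT).
by exists w; split=> //; move: wh; rewrite (tree_nil tT) /= cats0.
Qed.

End CyclomaticNumber.

(** * The rank of the fundamental group *)
Section EdgeParity.
Variables (K : groupType) (n : nat) (x : 'I_n -> K) (A : subgraph x).
Local Open Scope ring_scope.

(** The image of a walk in the cycle space modulo 2, read off on the edges E i:
    the parities of the numbers of passages through them. Modulo 2 the direction
    of travel does not matter, so inverse walks have the same vector. *)
Definition parity_vector m (E : 'I_m -> cayley_edge K n) (p : seq (dart K n)) :
    'rV['F_2]_m :=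
  \row_i (count (fun d : dart K n => d.1 == E i) p)%:R.

Variables (m : nat) (E : 'I_m -> cayley_edge K n).
Local Notation vec := (parity_vector E).

Lemma parity_vector_cat p q : vec (p ++ q) = vec p + vec q.
Proof. by apply/rowP => i; rewrite !mxE count_cat natrD. Qed.

Lemma parity_vector_flatten w : vec (flatten w) = \sum_(p <- w) vec p.
Proof.
elim: w => [|p w IHw]; first by rewrite big_nil; apply/rowP => i; rewrite !mxE.
by rewrite big_cons /= parity_vector_cat IHw.
Qed.

Lemma parity_vector_inv p : vec (walk_inv p) = vec p.
Proof. by apply/rowP => i; rewrite !mxE /walk_inv count_rev count_map. Qed.

Lemma parity_vector_homotopic u v p q : homotopic A u v p q -> vec p = vec q.
Proof.
elim=> {p q} [//|//|p q r _ -> _ //|p d q _].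
apply/rowP => i; rewrite !mxE !count_cat /= !natrD; congr (_ + _).
by rewrite addrA -natrD addnn -mul2n natrM (pchar_Fp_0 (isT : prime 2)) mul0r add0r.
Qed.

(** The parity vectors of a generating family span the vectors of all closed
    walks, whence a lower bound on its size. *)
Lemma parity_vector_rank u s : generates_pi1 A u s ->
  (forall i, exists2 p, walk A u p u & vec p = delta_mx 0 i) -> (m <= size s)%N.
Proof.
move=> [_ gen] basis.
pose M : 'M['F_2]_(size s, m) := \matrix_(k < size s) vec (nth [::] s k).
have sM q : q \in s -> (vec q <= M)%MS.
  move=> qs; have qi : (index q s < size s)%N by rewrite index_mem.
  have -> : vec q = row (Ordinal qi) M by rewrite rowK nth_index.
  exact: row_sub.
have : (1%:M <= M)%MS.
  apply/row_subP => i; rewrite row1; have [p pu <-] := basis i.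
  have [w [ws /parity_vector_homotopic ->]] := gen p pu.
  rewrite parity_vector_flatten big_seq; apply: summx_sub => q /ws /orP[/sM//|/sM].
  by rewrite parity_vector_inv.
move/mxrankS; rewrite mxrank1 => /leq_trans; apply; exact: rank_leq_row.
Qed.

End EdgeParity.

Section Beta2.
Variables (K : groupType) (n : nat) (x : 'I_n -> K) (A : subgraph x).
Local Open Scope fset_scope.

Lemma pi1_rank_connected u : connected_subgraph A -> u \in vertices A ->
  (pi1_rank A u + beta0 A = #|` edges A| + 1)%N.
Proof.
move=> Ac uA; have [T [t tT]] := spanning_tree_exists Ac uA.
rewrite -(card_chords tT) /beta0; congr (_ + _)%N.
set C := chords A T.
have szC : size (chord_loops A T t) = #|` C| by rewrite size_map.
have gen := chord_loops_generate tT.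
have lower s : generates_pi1 A u s -> (#|` C| <= size s)%N.
  move=> gs.
  pose E (i : 'I_#|` C|) := tnth (in_tuple (enum_fset C)) i.
  (* each chord loop passes once through its chord and through no other chord *)
  apply: (@parity_vector_rank _ _ _ A _ E u s gs) => i.
  have EC : E i \in C by exact: mem_tnth.
  exists (chord_loop x t (E i)); first exact: (chord_loop_closed tT).
  have [EA ET] : E i \in edges A /\ E i \notin T.
    by move: EC; rewrite inE => /andP[].
  have [sA tA] := edges_incident EA.
  apply/rowP => j; rewrite !mxE eqxx /=.
  have jT : E j \notin T.
    by have : E j \in C by [exact: mem_tnth]; rewrite inE => /andP[].
  have tree0 v : v \in vertices A -> count (fun d : dart K n => d.1 == E j) (t v) = 0%N.
    move=> vA; apply/eqP; rewrite -leqn0 leqNgt -has_count; apply/hasPn => d dv.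
    apply: contra jT => /eqP <-; exact: (tree_walk_edges tT vA dv).
  rewrite count_cat /= /walk_inv count_rev count_map tree0//.
  rewrite -[count _ _]/(count (fun d : dart K n => d.1 == E j)
    (t (edge_target x (E i)))).
  rewrite tree0// add0n addn0.
  congr (_ %:R)%R; congr nat_of_bool.
  by rewrite /E !(tnth_nth (E i)) /= nth_uniq ?fset_uniq// eq_sym.
rewrite /pi1_rank; case: xgetP => [k _ [[s gs <-] smin]|none].
  by apply/eqP; rewrite eqn_leq lower// -szC smin.
exfalso; apply: (none #|` C|); split; last exact: lower.
by exists (chord_loops A T t).
Qed.

Lemma component_connected u : connected_subgraph A -> u \in vertices A ->
  component A u = vertices A.
Proof.
move=> [_ Ac] uA; apply/fsetP => v; rewrite !inE /=.
by have [vA|//] := boolP (v \in vertices A); apply/asboolP; exact: Ac.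
Qed.

(** Euler's formula for a connected subgraph. *)
Lemma beta2_connected : connected_subgraph A -> (beta2 A + beta0 A = #|` edges A| + 1)%N.
Proof.
move=> Ac; have /fset0Pn[u0 u0A] : vertices A != fset0 by case: Ac.
have compE : components A = [fset vertices A].
  apply/fsetP => C; rewrite inE; apply/imfsetP/eqP => [[u /= uA ->]|->].
    exact: component_connected.
  by exists u0 => //=; rewrite component_connected.
rewrite /beta2 compE big_seq_fset1 pi1_rank_connected//.
rewrite /base_vertex; have : u0 \in enum_fset (vertices A) by [].
rewrite -[_ \in vertices A]/(_ \in enum_fset (vertices A)).
by case: (enum_fset (vertices A)) => //= a l _; rewrite inE eqxx.
Qed.

End Beta2.

(** * Subgraphs induced by finite sets *)
Section InducedSubgraph.
Variables (K : groupType) (n : nat) (x : 'I_n -> K).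
Local Open Scope fset_scope.
Local Open Scope group_scope.
Implicit Types (S A B U : {fset K}).

(** The edges that start in S. *)
Definition edges_from S : seq (cayley_edge K n) :=
  [seq (g, j) | j <- enum 'I_n, g <- enum_fset S].

(** The edges with both ends in S. *)
Definition inner_edges S : {fset cayley_edge K n} :=
  [fset e in [seq e <- edges_from S | edge_target x e \in S]].

Lemma in_inner_edges S e :
  (e \in inner_edges S) = (edge_source e \in S) && (edge_target x e \in S).
Proof.
rewrite in_fset /= mem_filter andbC; congr andb.
apply/allpairsP/idP => [[[j g] /= [_ gS ->]] //|eS].
by exists (e.2, e.1); rewrite mem_enum; split=> //; case: e eS.
Qed.

Fact induced_incident S e : e \in inner_edges S ->
  edge_source e \in S /\ edge_target x e \in S.
Proof. by rewrite in_inner_edges => /andP. Qed.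

(** The subgraph spanned by S. *)
Definition induced S : subgraph x := Subgraph (@induced_incident S).

(** S spans a connected subgraph; in particular S is not empty. *)
Definition cayley_connected S := connected_subgraph (induced S).

(** Left translation: it acts on the Cayley graph by automorphisms. *)
Definition translate (g : K) S : {fset K} := [fset g * s | s in S].

Lemma mem_translate g S s : (g * s \in translate g S) = (s \in S).
Proof. by rewrite mem_imfset //; exact: mulgI. Qed.

Lemma mem_translateV g S s : (s \in translate g S) = (g^-1 * s \in S).
Proof. by rewrite -{1}(mulVKg g s) mem_translate. Qed.

Lemma card_translate g S : #|` translate g S| = #|` S|.
Proof. by rewrite card_imfset //; exact: mulgI. Qed.

Lemma translate_eq0 g S : (translate g S == fset0) = (S == fset0).
Proof. by rewrite -!cardfs_eq0 card_translate. Qed.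

Lemma induced_le S U : S `<=` U -> subgraph_le (induced S) (induced U).
Proof.
move=> SU; split=> //; apply/fsubsetP => e; rewrite !in_inner_edges => /andP[].
by move=> /(fsubsetP SU) -> /(fsubsetP SU) ->.
Qed.

Lemma reachable_refl (A : subgraph x) u : reachable A u u.
Proof. by exists [::] => /=. Qed.

Lemma reachable_sym (A : subgraph x) u v : reachable A u v -> reachable A v u.
Proof. by case=> p up; exists (walk_inv p); exact: walk_inverse. Qed.

Lemma reachable_trans (A : subgraph x) u v w :
  reachable A u v -> reachable A v w -> reachable A u w.
Proof. by case=> p up [q vq]; exists (p ++ q); exact: walk_concat up vq. Qed.

Lemma reachable_le (A B : subgraph x) u v :
  subgraph_le A B -> reachable A u v -> reachable B u v.
Proof.
case=> _ AB [p up]; exists p; elim: p u up => //= d p IHp u /and3P[dA -> /IHp ->].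
by rewrite (fsubsetP AB).
Qed.

Lemma reachable_step S g j : g \in S -> g * x j \in S -> reachable (induced S) g (g * x j).
Proof.
move=> gS gxS; exists [:: ((g, j), true)] => /=.
rewrite /dart_start /dart_end /edge_source /edge_target /= !eqxx.
by rewrite in_inner_edges /= /edge_source /edge_target /= gS gxS.
Qed.

Lemma reachable_translate g S u v :
  reachable (induced S) u v -> reachable (induced (translate g S)) (g * u) (g * v).
Proof.
case=> p; elim: p u => [|[e b] p IHp] u /=; first by move/eqP->; exact: reachable_refl.
case/and3P; rewrite in_inner_edges => /andP[sS tS] /eqP <- /IHp.
apply: reachable_trans.
have H : reachable (induced (translate g S)) (g * edge_source e) (g * edge_target x e).
  by rewrite /edge_target mulgA; apply: reachable_step; rewrite -?mulgA mem_translate.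
by case: b => /=; [exact: H|exact: reachable_sym H].
Qed.

Lemma connected_translate g S : cayley_connected S -> cayley_connected (translate g S).
Proof.
move=> [S0 Sc]; split=> [|u v]; first by rewrite /= translate_eq0.
rewrite /= !mem_translateV => uS vS.
by rewrite -(mulVKg g u) -(mulVKg g v); apply: reachable_translate; exact: Sc.
Qed.

Lemma connected_fsetU A B a b : cayley_connected A -> cayley_connected B ->
  a \in A -> b \in B -> reachable (induced (A `|` B)) a b -> cayley_connected (A `|` B).
Proof.
move=> [_ Ac] [_ Bc] aA bB ab.
have H u : u \in A `|` B -> reachable (induced (A `|` B)) a u.
  rewrite in_fsetU => /orP[uA|uB].
    by apply: reachable_le (Ac _ _ aA uA); apply: induced_le; exact: fsubsetUl.
  apply: reachable_trans ab _.
  by apply: reachable_le (Bc _ _ bB uB); apply: induced_le; exact: fsubsetUr.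
split=> [|u v uA vA].
  by apply/fset0Pn; exists a; rewrite in_fsetU aA.
exact: reachable_trans (reachable_sym (H _ uA)) (H _ vA).
Qed.

Lemma connected1 g : cayley_connected [fset g].
Proof.
split=> [|u v]; first by apply/fset0Pn; exists g; rewrite inE.
by rewrite !inE => /eqP-> /eqP->; exact: reachable_refl.
Qed.

End InducedSubgraph.

(** * The edge boundary *)
Section Boundary.
Variables (K : groupType) (n : nat) (x : 'I_n -> K).
Local Open Scope fset_scope.
Local Open Scope group_scope.
Implicit Types (S A B U : {fset K}).

(** The number of edges that leave S. A loop or an edge inside S does not
    count, and edges with the same ends count with multiplicity. *)
Definition boundary S : nat := (\sum_(j < n) \sum_(g <- S) ((g * x j)%g \notin S))%N.

(** The boundary as a sum over a larger index set, so that the boundaries of several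
    sets can be compared term by term. *)
Lemma boundary_widen S U : S `<=` U ->
  boundary S = (\sum_(j < n) \sum_(g <- U) ((g \in S) && ((g * x j)%g \notin S)))%N.
Proof.
move=> SU; apply: eq_bigr => j _; rewrite -(big_fset_incl _ SU)/=; last first.
  by move=> g _ /negbTE ->.
by rewrite big_seq [RHS]big_seq; apply: eq_bigr => g ->.
Qed.

Lemma card_inner_edges S : (#|` inner_edges x S| + boundary S = n * #|` S|)%N.
Proof.
have -> : #|` inner_edges x S| = (\sum_(j < n) \sum_(g <- S) ((g * x j)%g \in S))%N.
  rewrite card_fseq undup_id; last first.
    apply/filter_uniq/allpairs_uniq; rewrite ?enum_uniq ?fset_uniq//.
    by move=> [i g] [j h] _ _ [-> ->].
  rewrite size_filter -sum1_count big_mkcond /edges_from big_allpairs_dep /= big_enum /=.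
  by apply: eq_bigr => j _; apply: eq_bigr => g _; rewrite /edge_target /=; case: (_ \in S).
rewrite /boundary -big_split /= (eq_bigr (fun=> #|` S|)).
  by rewrite sum_nat_const card_ord.
move=> j _; rewrite -big_split /= -sum1_size; apply: eq_bigr => g _.
by case: (_ \in S).
Qed.

Lemma boundary_submod A B :
  (boundary (A `|` B) + boundary (A `&` B) <= boundary A + boundary B)%N.
Proof.
have IU : A `&` B `<=` A `|` B by apply: fsubset_trans (fsubsetIl _ _) (fsubsetUl _ _).
rewrite (boundary_widen (fsubset_refl (A `|` B))) (boundary_widen IU).
rewrite (boundary_widen (fsubsetUl A B)) (boundary_widen (fsubsetUr A B)) -!big_split /=.
apply: leq_sum => j _; rewrite -!big_split /=; apply: leq_sum => g _.
by rewrite !inE; do 4!case: (_ \in _).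
Qed.

Lemma boundaryU A B : (boundary (A `|` B) <= boundary A + boundary B)%N.
Proof. exact: leq_trans (leq_addr _ _) (boundary_submod A B). Qed.

Lemma boundary_adjacent A B g j : [disjoint A & B] -> g \in A -> g * x j \in B ->
  (boundary (A `|` B) < boundary A + boundary B)%N.
Proof.
move=> dAB gA gB.
rewrite (boundary_widen (fsubset_refl (A `|` B))).
rewrite (boundary_widen (fsubsetUl A B)) (boundary_widen (fsubsetUr A B)) -!big_split /=.
rewrite (bigD1 j)//= [X in (_ < X)%N](bigD1 j)//= -addSn; apply: leq_add; last first.
  apply: leq_sum => i _; rewrite -!big_split /=; apply: leq_sum => h _.
  by rewrite !inE; do 4!case: (_ \in _).
have gU : g \in A `|` B by rewrite inE gA.
rewrite -!big_split /= !(big_fsetD1 g gU)/= -addSn; apply: leq_add; last first.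
  apply: leq_sum => h _; by rewrite !inE; do 4!case: (_ \in _).
have gxA : g * x j \notin A by rewrite (fdisjointP_sym dAB).
by rewrite !inE gA gB (negbTE gxA) orbT.
Qed.

Lemma boundary_separated A B :
  (forall g j, g \in A -> g * x j \notin B) -> (forall g j, g \in B -> g * x j \notin A) ->
  [disjoint A & B] -> (boundary A + boundary B <= boundary (A `|` B))%N.
Proof.
move=> AB BA dAB.
rewrite (boundary_widen (fsubset_refl (A `|` B))).
rewrite (boundary_widen (fsubsetUl A B)) (boundary_widen (fsubsetUr A B)) -!big_split /=.
apply: leq_sum => j _; rewrite -!big_split /=; apply: leq_sum => g _.
rewrite !in_fsetU; have [gA|gA] := boolP (g \in A).
  by rewrite (negbTE (AB _ j gA)) (negbTE (fdisjointP dAB _ gA)) /= addn0 orbF leqnn.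
have [gB|//] := boolP (g \in B).
by rewrite (negbTE (BA _ j gB)) /= leqnn.
Qed.

Lemma boundary_translate h S : boundary (translate h S) = boundary S.
Proof.
apply: eq_bigr => j _; rewrite /translate big_imfset /=; last by move=> a b _ _; exact: mulgI.
by apply: eq_bigr => g _; rewrite -mulgA mem_translate.
Qed.

End Boundary.

(** * Large connected sets of small boundary *)
Section Growth.
Variables (K : groupType) (n : nat) (x : 'I_n -> K).
Hypothesis gen : forall g : K, exists w : word n, eval_word x w = g.
Local Open Scope fset_scope.
Local Open Scope group_scope.
Implicit Types (S A B U : {fset K}).

(** Right translation by a generator permutes a finite set that it stabilises, so
    such a set is stable under the inverse generators too. *)
Lemma stable_full S g h : (forall u j, u \in S -> u * x j \in S) -> g \in S -> h \in S.
Proof.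
move=> Sx gS.
have SxV u j : u \in S -> u * (x j)^-1 \in S.
  have inj : injective (fun v => v * x j) by exact: mulIg.
  have SE : [fset v * x j | v in S] = S.
    apply/eqP; rewrite eqEfcard card_imfset//= leqnn andbT.
    by apply/fsubsetP => _ /imfsetP[v /= vS ->]; exact: Sx.
  by rewrite -{1}SE => /imfsetP[v /= vS ->]; rewrite mulgK.
have H w u : u \in S -> u * eval_word x w \in S.
  rewrite /eval_word; elim: w u => [|[j b] w IHw] u uS; first by rewrite big_nil mulg1.
  rewrite big_cons mulgA; apply: IHw; case: b => /=; [exact: Sx|exact: SxV].
have [w wE] := gen (g^-1 * h).
by rewrite -(mulVKg g h) -wE; exact: H.
Qed.

Lemma boundary_edge S g h : g \in S -> h \notin S ->
  exists u j, u \in S /\ u * x j \notin S.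
Proof.
move=> gS; apply: contraNP => none; apply: stable_full gS => u j uS.
by apply: contrapT => /negP uxS; apply: none; exists u, j.
Qed.

Lemma boundary_gt0 S u j : u \in S -> u * x j \notin S -> (0 < boundary x S)%N.
Proof.
move=> uS uxS; by rewrite /boundary (bigD1 j)//= (big_fsetD1 u uS)/= uxS !addn_gt0.
Qed.

Variable R : realFieldType.
Local Open Scope ring_scope.

Local Notation "'bd' S" := ((boundary x S)%:R : R) (at level 10).
Local Notation "'cd' S" := (#|` S|%:R : R) (at level 10).

(** If a finite set has ratio (1 - boundary) / size at least r, then so has a
    connected subset, namely one of its connected components: boundaries and sizes
    of components add up. *)
Lemma connected_subset_ratio (r : R) S : S != fset0 -> r * cd S + bd S <= 1 ->
  exists A, [/\ A `<=` S, cayley_connected x A & r * cd A + bd A <= 1].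
Proof.
have [m] := ubnP #|` S|; elim: m S => // m IHm S Sm S0 rS.
have [Sc|Snc] := pselect (cayley_connected x S); first by exists S.
have [u [v [uS vS uv]]] : exists u v, [/\ u \in S, v \in S & ~ reachable (induced x S) u v].
  apply: contrapT => none; apply: Snc; split=> // u v uS vS.
  by apply: contrapT => uv; apply: none; exists u, v.
pose C := [fset a in S | `[< reachable (induced x S) u a >]].
have CE a : (a \in C) = (a \in S) && `[< reachable (induced x S) u a >] by rewrite !inE.
pose D := S `\` C.
have CS : C `<=` S by apply/fsubsetP => a; rewrite CE => /andP[].
have DS : D `<=` S by exact: fsubsetDl.
have uC : u \in C by rewrite CE uS; apply/asboolP; exact: reachable_refl.
have vD : v \in D by rewrite in_fsetD vS CE vS andbT /= ; apply/asboolPn.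
have dCD : [disjoint C & D].
  by apply/fdisjointP => a aC; rewrite in_fsetD aC.
have CDS : C `|` D = S.
  by rewrite fsetUDl fsetDv fsetD0; apply/fsetUidPr.
have CD g j : (g \in C -> g * x j \notin D)%g.
  move=> gC; apply/negP => gxD; move: (gC); rewrite CE => /andP[gS /asboolP ug].
  have gxS := fsubsetP DS _ gxD.
  move: gxD; rewrite in_fsetD CE gxS andbT => /asboolPn; apply.
  exact: reachable_trans ug (reachable_step gS gxS).
have DC g j : (g \in D -> g * x j \notin C)%g.
  move=> gD; apply/negP => gxC; move: (gxC); rewrite CE => /andP[gxS /asboolP ug].
  have gS := fsubsetP DS _ gD.
  move: gD; rewrite in_fsetD CE gS andbT => /asboolPn; apply.
  exact: reachable_trans ug (reachable_sym (reachable_step gS gxS)).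
have bCD := boundary_separated CD DC dCD; rewrite CDS in bCD.
have cCD : (#|` C| + #|` D| = #|` S|)%N.
  by rewrite -CDS cardfsU (disjoint_fsetI0 dCD) cardfs0 subn0.
have C0 : (0 < #|` C|)%N by rewrite cardfs_gt0; apply/fset0Pn; exists u.
have D0 : (0 < #|` D|)%N by rewrite cardfs_gt0; apply/fset0Pn; exists v.
have [rC|rC] := leP (r * cd C + bd C) 1.
  have [||A [AC Ac rA]] := IHm C _ _ rC.
  - by rewrite -ltnS; apply: leq_trans Sm; rewrite ltnS -cCD -addn1 leq_add2l.
  - by rewrite -cardfs_gt0.
  by exists A; split=> //; exact: fsubset_trans AC CS.
have rD : r * cd D + bd D <= 1.
  have := bCD; rewrite -(ler_nat R) natrD => bCD'.
  by move: rS; rewrite -cCD natrD; lra.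
have [||A [AD Ac rA]] := IHm D _ _ rD.
- by rewrite -ltnS; apply: leq_trans Sm; rewrite ltnS -cCD -add1n leq_add2r.
- by rewrite -cardfs_gt0.
by exists A; split=> //; exact: fsubset_trans AD DS.
Qed.

Lemma boundary_le S : (boundary x S <= n * #|` S|)%N.
Proof. by rewrite -(card_inner_edges x) leq_addl. Qed.

(** There is a set A of largest ratio a among the non-empty sets with at most M
    elements, which moreover is connected and of largest size among the connected
    sets of this ratio. *)
Lemma extremal_connected (r : R) S M : cayley_connected x S -> (#|` S| <= M)%N ->
  r * cd S + bd S <= 1 ->
  exists a A, [/\ r <= a, cayley_connected x A, (#|` A| <= M)%N, a * cd A + bd A = 1 &
    (forall B, B != fset0 -> (#|` B| <= M)%N -> 1 <= a * cd B + bd B) /\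
    (forall B, cayley_connected x B -> (#|` B| <= M)%N -> a * cd B + bd B = 1 ->
      (#|` B| <= #|` A|)%N)].
Proof.
move=> Sc SM rS.
have card_pos B : cayley_connected x B -> 0 < cd B.
  by case=> B0 _; rewrite ltr0n cardfs_gt0.
(* up to the constraint on sizes, only finitely many pairs of a size and a
   boundary occur *)
pose P (p : 'I_M.+1 * 'I_(n * M).+1) :=
  `[< exists B, [/\ cayley_connected x B, #|` B| = p.1 :> nat & boundary x B = p.2 :> nat] >].
pose F (p : 'I_M.+1 * 'I_(n * M).+1) : R := (1 - p.2%:R) / p.1%:R.
pose pair B : 'I_M.+1 * 'I_(n * M).+1 := (inord #|` B|, inord (boundary x B)).
have pairE B : (#|` B| <= M)%N ->
    (pair B).1 = #|` B| :> nat /\ (pair B).2 = boundary x B :> nat.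
  move=> BM; rewrite /pair /= !inordK// ltnS.
  by apply: leq_trans (boundary_le B) _; rewrite leq_mul2l BM orbT.
have PB B : cayley_connected x B -> (#|` B| <= M)%N -> P (pair B).
  move=> Bc BM; have [B1 B2] := pairE _ BM.
  by apply/asboolP; exists B; split=> //; exact/esym.
case: (arg_maxP F (PB _ Sc SM)) => p /asboolP[A0 [A0c A01 A02]] pmax.
pose a := F p.
have max B : cayley_connected x B -> (#|` B| <= M)%N -> 1 <= a * cd B + bd B.
  move=> Bc BM; have [B1 B2] := pairE _ BM.
  have : (1 - bd B) / cd B <= a by rewrite -B1 -B2; exact: pmax _ (PB _ Bc BM).
  by rewrite ler_pdivrMr ?card_pos// => H; lra.
have A0M : (#|` A0| <= M)%N by rewrite A01 -ltnS.
have aA0 : a * cd A0 + bd A0 = 1.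
  by rewrite /a /F A01 A02 divfK ?subrK// -A01 gt_eqF// card_pos.
pose Q k := `[< exists B,
  [/\ cayley_connected x B, (#|` B| <= M)%N, a * cd B + bd B = 1 & #|` B| = k] >].
have exQ : exists k, Q k by exists #|` A0|; apply/asboolP; exists A0.
have ubQ k : Q k -> (k <= M)%N by move=> /asboolP[B [_ BM _ <-]].
case: (ex_maxnP exQ ubQ) => k /asboolP[A [Ac AM aA Ak]] kmax.
exists a, A; split=> //.
  have [S1 S2] := pairE _ SM.
  have : (1 - bd S) / cd S <= a by rewrite -S1 -S2; exact: pmax _ (PB _ Sc SM).
  apply: le_trans; rewrite ler_pdivlMr ?card_pos//; lra.
split=> [B B0 BM|B Bc BM aB]; last first.
  by rewrite Ak; apply: kmax; apply/asboolP; exists B.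
rewrite leNgt; apply/negP => aB.
have cdB : 0 < cd B by rewrite ltr0n cardfs_gt0.
(* otherwise the ratio b of B exceeds a, and so does the ratio of a component *)
pose b := (1 - bd B) / cd B.
have bB : b * cd B + bd B <= 1 by rewrite /b divfK ?gt_eqF// subrK.
have ab : a < b by rewrite /b ltr_pdivlMr//; lra.
have [C [CB Cc bC]] := connected_subset_ratio B0 bB.
have := max C Cc (leq_trans (fsubset_leq_card CB) BM).
have : a * cd C < b * cd C by rewrite ltr_pM2r// card_pos.
lra.
Qed.

(** In an infinite group a ratio (1 - boundary) / size that is reached by some finite
    set is also reached, or exceeded, by connected sets of arbitrarily large size.
    The infinitude of the group is expressed by the absence of a finite set that
    contains all elements. *)
Lemma large_connected (r : R) S M : (forall U, exists h, h \notin U) ->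
  S != fset0 -> r * cd S + bd S <= 1 ->
  exists A, [/\ cayley_connected x A, 1%g \in A, (M < #|` A|)%N & r * cd A + bd A <= 1].
Proof.
move=> inf S0 rS.
suff [A [Ac MA rA]] : exists A,
    [/\ cayley_connected x A, (M < #|` A|)%N & r * cd A + bd A <= 1].
  have [a aA] : exists a, a \in A by apply/fset0Pn; case: Ac.
  exists (translate a^-1%g A); split.
  - exact: connected_translate.
  - by rewrite mem_translateV invgK mulg1.
  - by rewrite card_translate.
  - by rewrite card_translate boundary_translate.
have [S' [_ S'c rS']] := connected_subset_ratio S0 rS.
have [MS'|S'M] := ltnP M #|` S'|; first by exists S'.
have [a [A [ra Ac AM aA [amin Amax]]]] := extremal_connected S'c S'M rS'.
have [g0 g0A] : exists a, a \in A by apply/fset0Pn; case: Ac.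
have [h hA] := inf A.
have [g [j [gA gxA]]] := boundary_edge g0A hA.
(* the translate of A that contains the end of an edge leaving A *)
pose k := (g * x j * g0^-1)%g.
pose B := translate k A.
have gxB : (g * x j)%g \in B by rewrite mem_translateV /k invgM invgK -mulgA mulVg mulg1.
have aB : a * cd B + bd B = 1 by rewrite card_translate boundary_translate.
pose U := A `|` B.
have AU : A `<=` U by exact: fsubsetUl.
have Uc : cayley_connected x U.
  apply: (connected_fsetU Ac (connected_translate k Ac) gA gxB).
  by apply: reachable_step; rewrite in_fsetU ?gA ?gxB ?orbT.
have cU : (#|` A| < #|` U|)%N.
  apply: fproper_ltn_card; rewrite fproperE AU /=; apply/negP => /fsubsetP/(_ (g * x j)%g).
  by rewrite in_fsetU gxB orbT (negbTE gxA) => /(_ isT).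
have aU : a * cd U + bd U <= 1.
  have [AB|AB] := boolP [disjoint A & B]%fset.
    have := boundary_adjacent AB gA gxB; rewrite -(ler_nat R) -natr1 natrD => H.
    have -> : cd U = cd A + cd B.
      by rewrite /U cardfsU (disjoint_fsetI0 AB) cardfs0 subn0 natrD.
    by rewrite -/U in H; lra.
  have := boundary_submod x A B; rewrite -(ler_nat R) !natrD => H.
  have /(congr1 (fun k => k%:R : R)) := cardfsUI A B; rewrite !natrD => cUI.
  have /(amin _) : A `&` B != fset0 by rewrite fsetI_eq0.
  move=> /(_ (leq_trans (fsubset_leq_card (fsubsetIl _ _)) AM)) aI.
  have : a * cd U + a * cd (A `&` B) = a * cd A + a * cd B by rewrite -!mulrDr cUI.
  rewrite -/U in H; lra.
exists U; split=> //.
  rewrite ltnNge; apply/negP => UM.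
  have U0 : U != fset0 by case: Uc.
  have /(Amax _ Uc UM) : a * cd U + bd U = 1.
    by apply/eqP; rewrite eq_le aU amin.
  by rewrite leqNgt cU.
have : r * cd U <= a * cd U by rewrite ler_wpM2r.
lra.
Qed.

End Growth.

(** * The isoperimetric constant *)
Section Isoperimetric.
Variables (R : realType) (K : groupType) (n : nat) (x : 'I_n -> K).
Local Open Scope fset_scope.
Local Open Scope ring_scope.
Implicit Types (S A U : {fset K}).

(** The infimum h of boundary(S) / |S| over the non-empty finite sets S. *)
Definition isoperimetric : R :=
  inf [set (boundary x S)%:R / #|` S|%:R | S in [set S : {fset K} | S != fset0]]%classic.

Local Notation h := isoperimetric.
Local Notation "'bd' S" := ((boundary x S)%:R : R) (at level 10).
Local Notation "'cd' S" := (#|` S|%:R : R) (at level 10).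

Lemma natr_card_gt0 S : S != fset0 -> 0 < cd S.
Proof. by move=> S0; rewrite ltr0n cardfs_gt0. Qed.

Let ratios := [set bd S / cd S | S in [set S : {fset K} | S != fset0]]%classic.

Let has_inf_ratios : has_inf ratios.
Proof.
split; last by exists 0 => _ [S _ <-]; rewrite divr_ge0.
have n0 : [fset 1%g : K] != fset0 by rewrite -cardfs_gt0 cardfs1.
by exists (bd [fset 1%g : K] / cd [fset 1%g : K]); exists [fset 1%g].
Qed.

Lemma isoperimetric_le S : S != fset0 -> h * cd S <= bd S.
Proof.
move=> S0; rewrite -ler_pdivlMr ?natr_card_gt0//; apply: ge_inf; first by case: has_inf_ratios.
by exists S.
Qed.

Lemma isoperimetric_glb a : (forall S, S != fset0 -> a * cd S <= bd S) -> a <= h.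
Proof.
move=> ha; apply: lb_le_inf; first by case: has_inf_ratios.
by move=> _ [S /= S0 <-]; rewrite ler_pdivlMr ?natr_card_gt0// ha.
Qed.

Lemma isoperimetric_ge0 : 0 <= h.
Proof. by apply: isoperimetric_glb => S S0; rewrite mul0r. Qed.

Lemma isoperimetric_adherent a : h < a -> exists S, S != fset0 /\ bd S < a * cd S.
Proof.
rewrite -subr_gt0 => ha; have [_ [S S0 <-]] := inf_adherent ha has_inf_ratios.
by rewrite -/h addrCA subrr addr0 ltr_pdivrMr ?natr_card_gt0// => H; exists S.
Qed.

Lemma boundary_full S : (forall g, g \in S) -> boundary x S = 0%N.
Proof. by move=> Sf; apply: big1 => j _; apply: big1 => g _; rewrite Sf. Qed.

Lemma isoperimetric_finite S : (forall g, g \in S) -> h = 0.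
Proof.
move=> Sf; have S0 : S != fset0 by apply/fset0Pn; exists 1%g.
apply/eqP; rewrite eq_le isoperimetric_ge0 andbT.
by have := isoperimetric_le S0; rewrite (boundary_full Sf) pmulr_lle0 ?natr_card_gt0.
Qed.

Lemma inv_card_full S : (forall g, g \in S) -> inv_card R K = (cd S)^-1.
Proof.
move=> Sf; have SE : [set` S]%classic = [set: K]%classic by apply/seteqP; split=> g // _ /=.
have fK : finite_set [set: K] by rewrite -SE; exact: finite_fset.
rewrite /inv_card asboolT//; congr (_%:R^-1); congr size.
by congr (enum_fset _); apply/fsetP => g; rewrite in_fset_set// Sf in_setT.
Qed.

Lemma inv_card_infinite : (forall U, exists g, g \notin U) -> inv_card R K = 0.
Proof.
move=> infK; rewrite /inv_card asboolF// => fK.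
have [g] := infK (fset_set [set: K]%classic).
by rewrite in_fset_set// in_setT.
Qed.

Lemma finite_or_infinite :
  (exists S, forall g, g \in S) \/ (forall U, exists g, g \notin U).
Proof.
have [?|none] := pselect (exists S, forall g, g \in S); [by left|right=> U].
apply: contrapT => Ufull; apply: none; exists U => g.
by apply: contrapT => gU; apply: Ufull; exists g; apply/negP.
Qed.

End Isoperimetric.

(** * The cyclomatic quotient in terms of the isoperimetric constant *)
Section Limsup.
Local Open Scope ereal_scope.
Variables (R : realType) (u : nat -> \bar R).

Lemma limn_esup_le b : (forall i, u i <= b) -> limn_esup u <= b.
Proof.
move=> ub; rewrite limn_esup_lim; apply: lime_le; first exact: is_cvg_esups.
by apply: nearW => i; apply: ge_ereal_sup => _ [k _ <-].
Qed.

Lemma limn_esup_ge b : (forall i, b <= u i) -> b <= limn_esup u.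
Proof.
move=> ub; rewrite limn_esup_lim; apply: lime_ge; first exact: is_cvg_esups.
apply: nearW => i; apply: le_trans (ub i) _; apply: ereal_sup_ubound.
by exists i => /=.
Qed.

End Limsup.

Section CyclomaticQuotient.
Variables (R : realType) (K : groupType) (n : nat) (x : 'I_n -> K).
Hypothesis gen : forall g : K, exists w : word n, eval_word x w = g.
Local Open Scope fset_scope.
Local Open Scope ring_scope.
Implicit Types (S A U : {fset K}).

Local Notation h := (isoperimetric R x).
Local Notation "'bd' S" := ((boundary x S)%:R : R) (at level 10).
Local Notation "'cd' S" := (#|` S|%:R : R) (at level 10).

Lemma xi_connected (A : subgraph x) : connected_subgraph A ->
  (1 - n%:R) + xi R A = (1 - n%:R * cd (vertices A) + #|` edges A|%:R) / cd (vertices A).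
Proof.
move=> Ac; have c0 : 0 < cd (vertices A) by case: Ac => /(@natr_card_gt0 R).
have /(congr1 (fun k => k%:R : R)) := beta2_connected Ac; rewrite /xi /beta0 !natrD => H.
apply: (mulIf (lt0r_neq0 c0)); rewrite mulrDl !divfK ?gt_eqF//.
lra.
Qed.

Lemma xi_induced S : cayley_connected x S ->
  (1 - n%:R) + xi R (induced x S) = (1 - bd S) / cd S.
Proof.
move=> Sc; rewrite xi_connected//=; congr (_ / _).
by have /(congr1 (fun k => k%:R : R)) := card_inner_edges x S; rewrite natrD natrM; lra.
Qed.

Lemma xi_le_boundary (A : subgraph x) : connected_subgraph A ->
  (1 - n%:R) + xi R A <= (1 - bd (vertices A)) / cd (vertices A).
Proof.
move=> Ac; rewrite xi_connected//= ler_wpM2r// ?invr_ge0//.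
have : edges A `<=` inner_edges x (vertices A).
  by apply/fsubsetP => e /edges_incident[sA tA]; rewrite in_inner_edges sA tA.
move/fsubset_leq_card; rewrite -(ler_nat R).
have /(congr1 (fun k => k%:R : R)) := card_inner_edges x (vertices A).
by rewrite natrD natrM; lra.
Qed.

(** For infinite K this says that the summand 1 does not help: sets of arbitrarily
    large size have at least the given ratio r, and for them 1 / size is negligible,
    so r <= - h. *)
Lemma boundary_ratio_le S : S != fset0 -> (1 - bd S) / cd S <= inv_card R K - h.
Proof.
move=> S0; have [[F Ff]|infK] := finite_or_infinite K.
  rewrite (isoperimetric_finite R x Ff) (inv_card_full R Ff) subr0.
  have [Sf|Snf] := pselect (forall g, g \in S).
    have -> : S = F by apply/fsetP => g; rewrite Sf Ff.
    by rewrite (boundary_full x Ff) subr0 div1r.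
  have [g gS] : exists g, g \notin S.
    apply: contrapT => Sfull; apply: Snf => g.
    by apply: contrapT => gS; apply: Sfull; exists g; apply/negP.
  have [g0 g0S] := fset0Pn _ S0.
  have [u [j [uS uxS]]] := boundary_edge gen g0S gS.
  have := boundary_gt0 uS uxS; rewrite -(ler_nat R) => b1.
  (* a proper non-empty subset has a boundary edge *)
  apply: (@le_trans _ _ 0); last by rewrite invr_ge0.
  by rewrite pmulr_lle0 ?invr_gt0 ?natr_card_gt0// subr_le0.
rewrite (inv_card_infinite R infK) sub0r.
set r := _ / _; have rS : r * cd S + bd S <= 1.
  by rewrite /r divfK ?subrK ?gt_eqF ?natr_card_gt0.
rewrite -subr_le0 opprK leNgt; apply/negP => rh.
have [A [Ac _ MA rA]] := large_connected gen (Num.truncn (r + h)^-1) infK S0 rS.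
have := @isoperimetric_le R _ _ x A (proj1 Ac); have : 1 < (r + h) * cd A.
  rewrite mulrC -ltr_pdivrMr// div1r; apply: lt_le_trans (truncnS_gt _) _.
  by rewrite ler_nat.
by rewrite mulrDl; lra.
Qed.

Lemma chain_le (A : nat -> subgraph x) : exhausting_chain A ->
  (limn_esup (fun i => (xi R (A i))%:E) <= (inv_card R K - h - (1 - n%:R))%:E)%E.
Proof.
case=> Ac _ _ _; apply: limn_esup_le => i; rewrite lee_fin lerBrDl.
by apply: le_trans (xi_le_boundary (Ac i)) _; apply: boundary_ratio_le; case: (Ac i).
Qed.

(** The group element that a generator or an inverse generator represents. *)
Definition letter (l : 'I_n * bool) : K := if l.2 then x l.1 else ((x l.1)^-1)%g.

(** The ball of radius 1 around U. *)
Definition neighbourhood U : {fset K} :=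
  U `|` [fset g in [seq (u * letter l)%g | u <- enum_fset U, l <- enum {: 'I_n * bool}]].

Lemma neighbourhood_sub U : U `<=` neighbourhood U.
Proof. exact: fsubsetUl. Qed.

Lemma neighbourhood_step U u l : u \in U -> (u * letter l)%g \in neighbourhood U.
Proof.
move=> uU; rewrite in_fsetU; apply/orP; right; rewrite in_fset /=.
by apply/allpairsP; exists (u, l); rewrite mem_enum.
Qed.

Lemma reachable_letter S u l : u \in S -> (u * letter l)%g \in S ->
  reachable (induced x S) u (u * letter l)%g.
Proof.
case: l => j [] uS lS; rewrite /letter /= in lS *; first exact: reachable_step.
apply: reachable_sym; rewrite -{2}(mulgVK (x j) u).
by apply: reachable_step => //; rewrite mulgVK.
Qed.

Lemma connected_root S r : r \in S -> (forall v, v \in S -> reachable (induced x S) r v) ->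
  cayley_connected x S.
Proof.
move=> rS rc; split=> [|u v uS vS]; first by apply/fset0Pn; exists r.
exact: reachable_trans (reachable_sym (rc _ uS)) (rc _ vS).
Qed.

Lemma connected_neighbourhood U : cayley_connected x U -> cayley_connected x (neighbourhood U).
Proof.
move=> [/fset0Pn[r rU] Uc]; apply: (@connected_root _ r) => [|v].
  exact: (fsubsetP (neighbourhood_sub U)).
have rN u : u \in U -> reachable (induced x (neighbourhood U)) r u.
  move=> uU; apply: reachable_le (Uc _ _ rU uU); exact: induced_le (neighbourhood_sub U).
rewrite in_fsetU => /orP[/rN//|]; rewrite in_fset /= => /allpairsP[[u l] /= [uU _ ->]].
apply: reachable_trans (rN _ uU) _; apply: reachable_letter.
  exact: (fsubsetP (neighbourhood_sub U)).
exact: neighbourhood_step.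
Qed.

Lemma eval_word_rcons w l : eval_word x (rcons w l) = (eval_word x w * letter l)%g.
Proof. by rewrite /eval_word -cats1 big_cat big_seq1. Qed.

Lemma connected_full S : (forall g, g \in S) -> cayley_connected x S.
Proof.
move=> Sf; apply: (@connected_root _ 1%g) => // v _; have [w <-] := gen v.
elim/last_ind: w => [|w l IHw].
  by rewrite /eval_word big_nil; exact: reachable_refl.
by rewrite eval_word_rcons; apply: reachable_trans IHw (reachable_letter _ _).
Qed.

Lemma chain_finite S : (forall g, g \in S) ->
  exists A : nat -> subgraph x, exhausting_chain A /\
    (forall i, inv_card R K - h - (1 - n%:R) <= xi R (A i)).
Proof.
move=> Sf; exists (fun=> induced x S); split.
  split=> [i|i|g|e].
  - exact: connected_full.
  - by split.
  - by exists 0%N => /=.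
  - by exists 0%N; rewrite /= in_inner_edges !Sf.
move=> i; rewrite (isoperimetric_finite R x Sf) (inv_card_full R Sf) subr0 lerBlDl.
by rewrite xi_induced ?(boundary_full x Sf) ?subr0 ?div1r//; exact: connected_full.
Qed.

(** For c < - h, a connected set U can be enlarged to a connected set of ratio at
    least c: the union of U with a large set of ratio r > c loses at most
    boundary(U) in the numerator. *)
Lemma extend_connected (c : R) U : (forall V : {fset K}, exists g, g \notin V) -> h < - c ->
  cayley_connected x U -> 1%g \in U ->
  exists V, [/\ U `<=` V, cayley_connected x V & c * cd V + bd V <= 1].
Proof.
move=> infK hc Uc U1; have [S [S0 Sc]] := isoperimetric_adherent hc.
pose r := - bd S / cd S.
have rS : r * cd S + bd S <= 1 by rewrite /r divfK ?gt_eqF ?natr_card_gt0// addNr.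
have cr : 0 < r - c.
  by rewrite subr_gt0 /r ltr_pdivlMr ?natr_card_gt0//; lra.
have c0 : c <= 0 by have := isoperimetric_ge0 R x; lra.
have [A [Ac A1 MA rA]] := large_connected gen (Num.truncn (bd U / (r - c))) infK S0 rS.
exists (U `|` A); split; first exact: fsubsetUl.
  by apply: (connected_fsetU Uc Ac U1 A1); exact: reachable_refl.
have := boundaryU x U A; rewrite -(ler_nat R) natrD => bUA.
have cUA : c * cd (U `|` A) <= c * cd A.
  by rewrite ler_wnM2l// ler_nat fsubset_leq_card// fsubsetUr.
have : bd U <= (r - c) * cd A.
  rewrite mulrC -ler_pdivrMr//; apply/ltW/(lt_le_trans (truncnS_gt _)).
  by rewrite ler_nat.
by rewrite mulrBl; lra.
Qed.

(** The chain alternates between passing to the neighbourhood, which makes it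
    exhausting, and an enlargement that restores the ratio. *)
Lemma chain_infinite (c : R) : (forall V : {fset K}, exists g, g \notin V) -> h < - c ->
  exists A : nat -> subgraph x, exhausting_chain A /\
    (forall i, c - (1 - n%:R) <= xi R (A i)).
Proof.
move=> infK hc.
have /choice[F FP] : forall U, exists V, cayley_connected x U -> 1%g \in U ->
    [/\ neighbourhood U `<=` V, cayley_connected x V & c * cd V + bd V <= 1].
  move=> U.
  have [[Uc U1]|nU] := pselect (cayley_connected x U /\ 1%g \in U).
    have [V VP] := extend_connected infK hc (connected_neighbourhood Uc)
      (fsubsetP (neighbourhood_sub U) _ U1).
    by exists V.
  by exists U => Uc U1; exfalso; apply: nU.
pose X i := iter i F [fset 1%g].
have X1 i : cayley_connected x (X i) /\ 1%g \in X i.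
  elim: i => [|i [Xc Xi]] /=; first by split; [exact: connected1|rewrite inE].
  have [NF Fc _] := FP _ Xc Xi; split=> //; apply: (fsubsetP NF).
  exact: (fsubsetP (neighbourhood_sub _)).
have XN i : neighbourhood (X i) `<=` X i.+1 by have [Xc Xi] := X1 i; have [] := FP _ Xc Xi.
have XS i : X i `<=` X i.+1 by exact: fsubset_trans (neighbourhood_sub _) (XN i).
have Xmono i k : (i <= k)%N -> X i `<=` X k.
  elim: k => [|k IHk]; first by rewrite leqn0 => /eqP->.
  rewrite leq_eqVlt => /orP[/eqP->//|/IHk ik]; exact: fsubset_trans ik (XS k).
have Xword w : eval_word x w \in X (size w).
  elim/last_ind: w => [|w l IHw]; first by rewrite /eval_word big_nil inE.
  rewrite eval_word_rcons size_rcons; apply: (fsubsetP (XN _)); exact: neighbourhood_step.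
have Xg g : exists i, g \in X i by have [w <-] := gen g; exists (size w).
(* the chain starts at X 1, because X 0 need not have ratio at least c *)
exists (fun i => induced x (X i.+1)); split; last first.
  move=> i; have [Xc Xi] := X1 i; have [_ Fc FX] := FP _ Xc Xi.
  rewrite lerBlDl xi_induced; last by have [] := X1 i.+1.
  by rewrite ler_pdivlMr ?natr_card_gt0//; [rewrite /=; lra | case: Fc].
split=> [i|i|g|e].
- by have [] := X1 i.+1.
- exact: induced_le.
- by have [i gi] := Xg g; exists i => /=; exact: (fsubsetP (XS i)).
- have [i si] := Xg (edge_source e); have [k tk] := Xg (edge_target x e).
  exists (maxn i k); rewrite in_inner_edges; apply/andP; split.
    exact: (fsubsetP (Xmono _ _ (leqW (leq_maxl i k)))).
  exact: (fsubsetP (Xmono _ _ (leqW (leq_maxr i k)))).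
Qed.

Lemma cyclomatic_quotientE :
  cyclomatic_quotient_of x R = (inv_card R K - h - (1 - n%:R))%:E.
Proof.
apply/eqP; rewrite eq_le; apply/andP; split.
  by apply: ge_ereal_sup => _ [A Ac <-]; exact: chain_le.
have sup_ge c : (exists A : nat -> subgraph x,
      exhausting_chain A /\ (forall i, c <= xi R (A i))) ->
    (c%:E <= cyclomatic_quotient_of x R)%E.
  move=> [A [Ac cA]]; apply: (@le_trans _ _ (limn_esup (fun i => (xi R (A i))%:E))).
    by apply: limn_esup_ge => i; rewrite lee_fin.
  by apply: ereal_sup_ubound; exists A.
have [[F Ff]|infK] := finite_or_infinite K.
  exact/sup_ge/(chain_finite Ff).
apply/lee_addgt0Pr => e e0; rewrite -leeBlDr// -EFinB; apply: sup_ge.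
have he : h < - (- h - e) by rewrite opprB opprK ltrDr.
have [A [Ac Ah]] := chain_infinite infK he; exists A; split=> // i.
by apply: le_trans (Ah i); rewrite (inv_card_infinite R infK) sub0r addrAC.
Qed.

End CyclomaticQuotient.

Lemma normalized_cyclomatic_quotientE (R : realType) (n : nat) (K : groupType)
    (P : presentation n K) :
  normalized_cyclomatic_quotient R P = (inv_card R K - isoperimetric R (gens P))%:E.
Proof.
rewrite /normalized_cyclomatic_quotient /cyclomatic_quotient.
rewrite cyclomatic_quotientE; last exact: gens_generate.
by rewrite -EFinD addrC subrK.
Qed.

(** * The isoperimetric inequality for functions *)
Section LayerCake.
Variables (R : realType) (K : groupType) (n : nat) (x : 'I_n -> K).
Local Open Scope fset_scope.
Local Open Scope ring_scope.

Lemma fset_argmin (S : {fset K}) (f : K -> R) : S != fset0 ->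
  exists2 g, g \in S & forall u, u \in S -> f g <= f u.
Proof.
case/fset0Pn => g0 g0S.
case: (@arg_minP _ R S [` g0S] xpredT (fun u => f (val u)) isT) => g _ gmin.
exists (val g); first exact: valP.
by move=> u uS; exact: (gmin [` uS] isT).
Qed.

(** The isoperimetric inequality for a non-negative function f of finite support,
    by induction on the size of the support S: subtracting the minimum c of f on S
    from f on S makes S smaller and changes the two sides by c |S| and by c times
    the boundary of S. *)
Lemma layer_cake (a : R) (U : {fset K}) (f : K -> R) :
  (forall S : {fset K}, S != fset0 -> a * #|` S|%:R <= (boundary x S)%:R) ->
  (forall g, 0 <= f g) -> (forall g, g \notin U -> f g = 0) ->
  a * \sum_(g <- U) f g <= \sum_(j < n) \sum_(g <- U) Num.max 0 (f g - f (g * x j)%g).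
Proof.
move=> ha; pose supp f := [fset g in U | 0 < f g :> R].
have [m] := ubnP #|` supp f|; elim: m f => // m IHm f fm f0 fU.
have [S0|S0] := eqVneq (supp f) fset0.
  have fE g : f g = 0.
    have [gU|/fU//] := boolP (g \in U); apply/eqP; rewrite eq_le f0 andbT leNgt.
    by apply/negP => fg; have : g \in supp f by [rewrite !inE gU]; rewrite S0 inE.
  rewrite big1 ?mulr0// sumr_ge0// => j _; apply: sumr_ge0 => g _.
  by rewrite le_max lexx.
set S := supp f in S0 fm *; have [g0 g0S fmin] := fset_argmin f S0.
have SE g : (g \in S) = (0 < f g).
  rewrite !inE /=; have [//|/fU ->] := boolP (g \in U); by rewrite ltxx.
have SU : S `<=` U by apply/fsubsetP => g; rewrite !inE => /andP[].
pose c := f g0; have c0 : 0 < c by rewrite /c -SE.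
pose f' g := f g - c * (g \in S)%:R.
have f'0 g : 0 <= f' g.
  rewrite /f'; have [gS|gS] := boolP (g \in S); last by rewrite mulr0 subr0.
  by rewrite mulr1 subr_ge0 fmin.
have f'U g : g \notin U -> f' g = 0.
  move=> gU; have gS : g \notin S by apply: contra gU; exact: (fsubsetP SU).
  by rewrite /f' (negbTE gS) mulr0 subr0 fU.
have f'm : (#|` supp f'| < m)%N.
  rewrite -ltnS; apply: leq_trans fm; rewrite ltnS; apply: fproper_ltn_card.
  rewrite fproperE; apply/andP; split.
    apply/fsubsetP => g; rewrite SE inE /= => /andP[_] /lt_le_trans; apply.
    by rewrite /f' gerBl mulr_ge0// ltW.
  apply/negP => /fsubsetP /(_ g0 g0S); rewrite inE /= => /andP[_].
  by rewrite /f' g0S mulr1 subrr ltxx.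
have := IHm f' f'm f'0 f'U.
have := ha S S0; rewrite (boundary_widen x SU).
have -> : \sum_(g <- U) f g = \sum_(g <- U) f' g + c * #|` S|%:R.
  have -> : #|` S|%:R = \sum_(g <- U) (g \in S)%:R :> R.
    rewrite -(big_fset_incl _ SU)/=; last by move=> g _ /negbTE ->.
    by rewrite -sum1_size natr_sum big_seq [RHS]big_seq; apply: eq_bigr => g ->.
  by rewrite mulr_sumr -big_split; apply: eq_bigr => g _ /=; rewrite /f' subrK.
have -> : \sum_(j < n) \sum_(g <- U) Num.max 0 (f g - f (g * x j)%g) =
   \sum_(j < n) \sum_(g <- U) Num.max 0 (f' g - f' (g * x j)%g) +
   c * (\sum_(j < n) \sum_(g <- U) ((g \in S) && ((g * x j)%g \notin S)))%N%:R.
  rewrite natr_sum mulr_sumr -big_split; apply: eq_bigr => j _ /=.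
  rewrite natr_sum mulr_sumr -big_split; apply: eq_bigr => g _ /=.
  have gE u : u \notin S -> f u = 0.
    by rewrite SE -leNgt => fu; apply/eqP; rewrite eq_le fu f0.
  rewrite /f'; have [gS|gS] := boolP (g \in S);
    have [hS|hS] := boolP ((g * x j)%g \in S) => /=.
  - by rewrite !mulr1 mulr0 addr0; congr Num.max; lra.
  - rewrite !mulr1 mulr0 subr0 (gE _ hS) subr0; have := fmin _ gS; rewrite -/c => cg.
    by rewrite !max_r ?subr0 ?f0 ?subr_ge0//; lra.
  - rewrite !mulr1 !mulr0 subr0 (gE _ gS) sub0r addr0; have := fmin _ hS; rewrite -/c => cg.
    by rewrite !max_l//; lra.
  - by rewrite !mulr0 !subr0 addr0.
rewrite mulrDr => H1 H2; rewrite lerD// mulrCA ler_wpM2l// ltW//.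
Qed.

End LayerCake.

(** * Monotonicity under projections *)
Section Projection.
Variables (R : realType) (G Q : groupType) (n : nat) (x : 'I_n -> G) (y : 'I_n -> Q).
Variable p : G -> Q.
Hypothesis px : forall g j, p (g * x j)%g = (p g * y j)%g.
Local Open Scope fset_scope.
Local Open Scope ring_scope.

Lemma card_fset_filter (T : choiceType) (S : {fset T}) (P : pred T) :
  #|` [fset g in S | P g]| = (\sum_(g <- S | P g) 1)%N.
Proof. by rewrite -sum1_size big_fset. Qed.

(** The size of the fibres of p on S is a function on Q to which [layer_cake]
    applies. *)
Lemma isoperimetric_projection : isoperimetric R y <= isoperimetric R x.
Proof.
apply: isoperimetric_glb => S S0.
pose U : {fset Q} := [fset p g | g in S].
pose fib q := [fset g in S | p g == q].
pose f q : R := #|` fib q|%:R.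
have fU q : q \notin U -> f q = 0.
  move=> qU; rewrite /f; suff -> : fib q = fset0 by rewrite cardfs0.
  apply/fsetP => g; rewrite !inE /=; apply/negP => /andP[gS /eqP pg].
  by move/negP: qU; apply; apply/imfsetP; exists g.
have := layer_cake (@isoperimetric_le R _ _ y) (fun q => ler0n R _ : 0 <= f q) fU.
have -> : \sum_(q <- U) f q = #|` S|%:R.
  rewrite -natr_sum -[#|` S|]sum1_size /U (partition_big_imfset _ p)/=; congr (_%:R).
  by apply: eq_bigr => q _; rewrite card_fset_filter.
move/le_trans; apply; rewrite /boundary natr_sum; apply: ler_sum => j _.
rewrite (partition_big_imfset _ p)/= natr_sum; apply: ler_sum => q _.
rewrite ge_max ler0n /= lerBlDr -natrD ler_nat [X in (X <= _)%N]card_fset_filter.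
(* the edges labelled j that stay in S inject the fibre over q into the fibre
   over q * y j *)
set A := [fset (g * x j)%g | g in [fset g in S | (p g == q) && ((g * x j)%g \in S)]].
have -> : (\sum_(g <- S | p g == q) 1 =
    \sum_(g <- S | p g == q) ((g * x j)%g \notin S) + #|` A|)%N.
  rewrite card_imfset/=; last exact: mulIg.
  rewrite card_fset_filter big_mkcondr -big_split; apply: eq_bigr => g _ /=.
  by case: ifP.
rewrite leq_add2l; apply: fsubset_leq_card; apply/fsubsetP => _ /imfsetP[g /= + ->].
by rewrite !inE /= => /and3P[gS /eqP <- ->]; rewrite px eqxx.
Qed.

End Projection.

(** * The Mazur-Orlicz theorem *)
Section MazurOrlicz.
Variables (R : realType) (V : lmodType R) (W : set V) (p : V -> R).
Local Open Scope classical_set_scope.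
Local Open Scope ring_scope.
Hypotheses (W0 : W 0) (WD : forall u v, W u -> W v -> W (u + v))
  (WZ : forall t u, W u -> W (t *: u)).
Hypotheses (pD : forall u v, W u -> W v -> p (u + v) <= p u + p v)
  (pZ : forall t u, 0 <= t -> W u -> p (t *: u) = t * p u).

(** A convex cone of pairs (u, r), with u in the subspace W and r <= p u. The pair
    (u, r) stands for the constraint r <= L u on a functional L. *)
Definition dominated_cone (A : set (V * R)) : Prop :=
  [/\ A (0, 0),
      forall u r v s, A (u, r) -> A (v, s) -> A (u + v, r + s),
      forall t u r, 0 <= t -> A (u, r) -> A (t *: u, t * r) &
      forall u r, A (u, r) -> W u /\ r <= p u].

(** Zorn's lemma. The chain that is considered may be empty, which is why the sets
    are taken in union with A0. *)
Lemma maximal_dominated_cone A0 : dominated_cone A0 ->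
  exists A, [/\ A0 `<=` A, dominated_cone A &
    forall B, A `<=` B -> dominated_cone B -> B `<=` A].
Proof.
move=> [A00 A0D A0Z A0p].
have [F FP Ftot|X [XP Xmax]] := @Zorn_bigcup _ [set X | dominated_cone (X `|` A0)].
  have inF a : (\bigcup_(X in F) X `|` A0) a -> A0 a \/ exists2 X, F X & (X `|` A0) a.
    by case=> [[X FX Xa]|]; [right; exists X => //; left|left].
  have Fin X a : F X -> (X `|` A0) a -> (\bigcup_(X in F) X `|` A0) a.
    by move=> FX [Xa|Aa]; [left; exists X|right].
  split; first by right.
  - move=> u r v s /inF[uA|[X FX Xu]] /inF[vA|[Y FY Yv]].
    + by right; exact: A0D.
    + apply: (Fin _ _ FY); have [_ YD _ _] := FP _ FY; apply: YD => //; by right.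
    + apply: (Fin _ _ FX); have [_ XD _ _] := FP _ FX; apply: XD => //; by right.
    + have [XY|YX] := Ftot _ _ FX FY.
      * apply: (Fin _ _ FY); have [_ YD _ _] := FP _ FY; apply: YD => //.
        by case: Xu; [left; exact: XY|right].
      * apply: (Fin _ _ FX); have [_ XD _ _] := FP _ FX; apply: XD => //.
        by case: Yv; [left; exact: YX|right].
  - move=> t u r t0 /inF[uA|[X FX Xu]]; first by right; exact: A0Z.
    by apply: (Fin _ _ FX); have [_ _ XZ _] := FP _ FX; exact: XZ.
  - move=> u r /inF[uA|[X FX Xu]]; first exact: A0p.
    by have [_ _ _ Xp] := FP _ FX; exact: Xp.
exists (X `|` A0); split=> // B XB Bc b Bb; left.
apply: contrapT => Xb; apply: (Xmax B); last first.
  by rewrite /= (_ : B `|` A0 = B)//; apply/setUidPl => a A0a; apply: XB; right.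
by split=> [a Xa|BX]; [apply: XB; left|exact: Xb (BX _ Bb)].
Qed.

(** A sublinear function p on W dominates an additive functional L that satisfies all
    constraints of a cone dominated by p. In a maximal dominated cone A, the
    largest r for which a pair (w, r) can be added is the infimum q w of
    p (w + v) - r' over the pairs (v, r') of A. By maximality (w, q w) belongs to
    A, which makes q superadditive, and subadditivity of p gives the rest. *)
Theorem mazur_orlicz A0 : dominated_cone A0 ->
  exists L : V -> R, [/\ forall u v, W u -> W v -> L (u + v) = L u + L v,
    forall u, W u -> L u <= p u &
    forall u r, A0 (u, r) -> r <= L u].
Proof.
move=> /maximal_dominated_cone[A [A0A [A00 AD AZ Ap] Amax]].
have p0 : p 0 = 0 by rewrite -(scale0r 0) pZ// mul0r.
have WN u : W u -> W (- u) by move=> Wu; rewrite -scaleN1r; exact: WZ.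
pose E w := [set p (w + a.1) - a.2 | a in A].
pose q w := inf (E w).
have E0 w : E w !=set0 by exists (p (w + 0) - 0), (0, 0).
have Elb w : W w -> lbound (E w) (- p (- w)).
  move=> Ww _ [[v r] /Ap[Wv rv] <-] /=.
  have := pD (WN _ Ww) (WD Ww Wv); rewrite addKr; lra.
have q_le w v r : W w -> A (v, r) -> q w <= p (w + v) - r.
  move=> Ww Avr; apply: ge_inf; first by exists (- p (- w)); exact: Elb.
  by exists (v, r).
have qp w : W w -> q w <= p w.
  by move=> Ww; have := q_le _ _ _ Ww A00; rewrite addr0 subr0.
have A_le_q v r : A (v, r) -> r <= q v.
  move=> Avr; apply: lb_le_inf => // _ [[u s] Aus <-] /=.
  by have [_] := Ap _ _ (AD _ _ _ _ Avr Aus); rewrite lerBrDr.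
have Aq w : W w -> A (w, q w).
  move=> Ww; pose B := [set b : V * R | exists v r t,
    [/\ A (v, r), 0 <= t & b = (v + t *: w, r + t * q w)]].
  apply: (Amax B); last 1 first.
  - by exists 0, 0, 1; rewrite !add0r scale1r mul1r ler01.
  - by move=> [v r] Avr; exists v, r, 0; rewrite scale0r mul0r !addr0 lexx.
  split.
  - by exists 0, 0, 0; rewrite scale0r mul0r !addr0 lexx.
  - move=> u r v s [u' [r' [t [Au t0 [-> ->]]]]] [v' [s' [t' [Av t'0 [-> ->]]]]].
    exists (u' + v'), (r' + s'), (t + t'); split; [exact: AD|exact: addr_ge0|].
    by rewrite scalerDl mulrDl addrACA [in LHS](addrACA r').
  - move=> t u r t0 [u' [r' [t' [Au t'0 [-> ->]]]]].
    exists (t *: u'), (t * r'), (t * t'); split; [exact: AZ|exact: mulr_ge0|].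
    by rewrite scalerDr mulrDr scalerA mulrA.
  - move=> u r [u' [r' [t [Au t0 [-> ->]]]]]; have [Wu ru] := Ap _ _ Au.
    split; first by apply: WD => //; exact: WZ.
    have [->|tn0] := eqVneq t 0; first by rewrite scale0r mul0r !addr0.
    have tp : 0 < t by rewrite lt0r tn0.
    have ti0 : 0 <= t^-1 by rewrite invr_ge0.
    have := q_le _ _ _ Ww (AZ _ _ _ ti0 Au).
    have -> : u' + t *: w = t *: (w + t^-1 *: u').
      by rewrite scalerDr scalerA divff// scale1r addrC.
    rewrite pZ//; last by apply: WD => //; exact: WZ.
    move/(ler_wpM2l t0); rewrite mulrBr mulrA divff// mul1r; lra.
have q0 : q 0 = 0.
  apply/eqP; rewrite eq_le -{1}p0 qp//=; exact: A_le_q.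
have q_super u v : W u -> W v -> q u + q v <= q (u + v).
  by move=> Wu Wv; apply: A_le_q; apply: AD; exact: Aq.
have qN v : W v -> - q (- v) <= q v.
  move=> Wv; apply: lb_le_inf => // _ [[v1 r1] A1 <-] /=.
  rewrite lerNl; apply: lb_le_inf => // _ [[v2 r2] A2 <-] /=.
  have [W1 _] := Ap _ _ A1; have [W2 _] := Ap _ _ A2.
  have [_ r12] := Ap _ _ (AD _ _ _ _ A1 A2).
  have := pD (WD Wv W1) (WD (WN _ Wv) W2).
  by rewrite addrACA subrr add0r; lra.
exists q; split=> [u v Wu Wv|//|u r /A0A/A_le_q//].
apply/eqP; rewrite eq_le q_super// andbT.
have := q_super _ _ (WD Wu Wv) (WN _ Wv); rewrite addrK.
have := qN _ Wv; lra.
Qed.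

End MazurOrlicz.

(** * Flows dual to the isoperimetric inequality *)
Section Flow.
Variables (R : realType) (K : groupType) (n : nat) (x : 'I_n -> K).
Local Open Scope fset_scope.
Local Open Scope ring_scope.

Local Notation V := (K -> 'I_n -> R^o).

(** The function w on the edges, where w g j is the value at the edge from g with
    label j, vanishes at the edges that start outside U. *)
Definition vanish_off (U : {fset K}) (w : V) : Prop := forall g j, g \notin U -> w g j = 0.

Definition finitely_supported : set V := [set w | exists U, vanish_off U w]%classic.

(** The integral of the positive part of w, for w of finite support. *)
Definition positive_part (w : V) : R :=
  \sum_(g <- fset_set [set g | exists j, w g j != 0]%classic)
    \sum_(j < n) Num.max 0 (w g j).

Lemma positive_partE U w : vanish_off U w ->
  positive_part w = \sum_(g <- U) \sum_(j < n) Num.max 0 (w g j).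
Proof.
move=> wU.
have supU : ([set g | exists j, w g j != 0] `<=` [set` U])%classic.
  by move=> g [j]; apply: contraNT => gU; rewrite wU.
have fin := sub_finite_set supU (finite_fset U).
apply: big_fset_incl.
  by apply/fsubsetP => g; rewrite in_fset_set// inE => /supU.
move=> g gU; rewrite in_fset_set// notin_setE => none.
apply: big1 => j _; rewrite (_ : w g j = 0) ?maxxx//.
by apply: contrapT => /eqP wj; apply: none; exists j.
Qed.

Lemma vanish_off_sub U U' w : U `<=` U' -> vanish_off U w -> vanish_off U' w.
Proof. by move=> UU' wU g j gU'; apply: wU; apply: contra gU'; exact: (fsubsetP UU'). Qed.

Lemma positive_partD (u v : V) : finitely_supported u -> finitely_supported v ->
  positive_part (u + v) <= positive_part u + positive_part v.
Proof.
move=> [A uA] [B vB].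
have uU := vanish_off_sub (fsubsetUl A B) uA; have vU := vanish_off_sub (fsubsetUr A B) vB.
have uvU : vanish_off (A `|` B) (u + v) by move=> g j gU; rewrite !fctE uU ?vU ?addr0.
rewrite (positive_partE uU) (positive_partE vU) (positive_partE uvU) -big_split.
apply: ler_sum => g _; rewrite -big_split; apply: ler_sum => j _ /=.
by rewrite !fctE ge_max addr_ge0 ?lerD ?le_max ?lexx ?orbT.
Qed.

Lemma positive_partZ (t : R) (u : V) : 0 <= t -> finitely_supported u ->
  positive_part (t *: u) = t * positive_part u.
Proof.
move=> t0 [U uU].
have tuU : vanish_off U (t *: u) by move=> g j gU; rewrite !fctE uU ?scaler0.
rewrite (positive_partE uU) (positive_partE tuU) mulr_sumr; apply: eq_bigr => g _.
rewrite mulr_sumr; apply: eq_bigr => j _.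
by rewrite !fctE -{1}(mulr0 t) -maxr_pMr.
Qed.

(** The decrease of f along the edges. *)
Definition outflow (f : K -> R) : V := fun g j => f g - f (g * x j)%g.

(** The indicator function of the edge from g with label j. *)
Definition point_edge (g : K) (j : 'I_n) : V := fun u i => ((u == g) && (i == j))%:R.

Lemma finitely_supported_point g j : finitely_supported (point_edge g j).
Proof.
by exists [fset g] => u i; rewrite inE /point_edge => /negbTE ->.
Qed.

(** The isoperimetric inequality is witnessed by a flow phi with values in [0, 1]
    and net outflow at least a at each vertex. The functional L given by
    [mazur_orlicz] is dominated by the integral of the positive part, which puts its
    values at single edges between 0 and 1, and satisfies
    a * (sum of f) <= L (outflow f) for each f >= 0 of finite support, which for
    the indicator function f of g is the bound on the net outflow at g. *)
Theorem isoperimetric_flow (a : R) :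
  (forall S : {fset K}, S != fset0 -> a * #|` S|%:R <= (boundary x S)%:R) ->
  exists phi : K -> 'I_n -> R,
    (forall g j, 0 <= phi g j <= 1) /\
    (forall g, a <= \sum_(j < n) (phi g j - phi (g * (x j)^-1)%g j)).
Proof.
move=> ha.
pose A0 : set (V * R) := [set b | exists (U : {fset K}) (f : K -> R),
  [/\ forall g, 0 <= f g, forall g, g \notin U -> f g = 0,
      b.1 = outflow f & b.2 = a * \sum_(g <- U) f g]]%classic.
have outflowU U f : (forall g, g \notin U -> f g = 0) ->
    vanish_off (neighbourhood x U) (outflow f).
  move=> fU g j gN; rewrite /outflow !fU ?subrr//.
    apply: contra gN => gxU; rewrite -(mulgK (x j) g).
    exact: (@neighbourhood_step _ _ x U _ (j, false)).
  by apply: contra gN; exact: (fsubsetP (neighbourhood_sub x U)).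
have sumU (U U' : {fset K}) (f : K -> R) : U `<=` U' -> (forall g, g \notin U -> f g = 0) ->
    \sum_(g <- U) f g = \sum_(g <- U') f g.
  by move=> UU' fU; apply: big_fset_incl => // g _; exact: fU.
have A0cone : dominated_cone finitely_supported positive_part A0.
  split.
  - exists fset0, (fun=> 0); split=> //=; last by rewrite big_seq_fset0 mulr0.
    by apply/funext => g; apply/funext => j; rewrite /outflow subrr.
  - move=> _ _ _ _ [U [f [f0 fU /= -> ->]]] [U' [f' [f'0 f'U /= -> ->]]].
    exists (U `|` U'), (f \+ f') => /=; split.
    + by move=> g; rewrite addr_ge0.
    + by move=> g; rewrite in_fsetU negb_or => /andP[/fU -> /f'U ->]; rewrite addr0.
    + apply/funext => g; apply/funext => j; rewrite !fctE /outflow /=; lra.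
    + rewrite (sumU _ _ _ (fsubsetUl U U') fU) (sumU _ _ _ (fsubsetUr U U') f'U).
      by rewrite big_split mulrDr.
  - move=> t _ _ t0 [U [f [f0 fU /= -> ->]]]; exists U, (fun g => t * f g) => /=; split.
    + by move=> g; rewrite mulr_ge0.
    + by move=> g /fU ->; rewrite mulr0.
    + by apply/funext => g; apply/funext => j; rewrite !fctE /outflow /= -mulrBr.
    + by rewrite -mulr_sumr mulrCA.
  - move=> _ _ [U [f [f0 fU /= -> ->]]]; split.
      by exists (neighbourhood x U); exact: outflowU.
    apply: le_trans (layer_cake ha f0 fU) _.
    rewrite exchange_big (positive_partE (outflowU _ _ fU)).
    rewrite (sumU _ _ _ (neighbourhood_sub x U))//= => g /fU fg.
    by apply: big1 => j _; rewrite fg sub0r max_l// oppr_le0.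
have WD (u v : V) :
    finitely_supported u -> finitely_supported v -> finitely_supported (u + v).
  move=> [A uA] [B vB]; exists (A `|` B) => g j gU; rewrite !fctE.
  rewrite (vanish_off_sub (fsubsetUl A B) uA)// (vanish_off_sub (fsubsetUr A B) vB)//.
  exact: addr0.
have WZ (t : R) (u : V) : finitely_supported u -> finitely_supported (t *: u).
  by move=> [A uA]; exists A => g j gA; rewrite !fctE uA ?scaler0.
have W0 : finitely_supported (0 : V) by exists fset0.
have [L [LD Lp LA]] := mazur_orlicz W0 WD WZ positive_partD positive_partZ A0cone.
have L0 : L 0 = 0 by have := LD _ _ W0 W0; rewrite addr0; lra.
have LN u : finitely_supported u -> L (- u) = - L u.
  move=> Wu; have Wnu : finitely_supported (- u) by rewrite -scaleN1r; exact: WZ.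
  by apply/eqP; rewrite -addr_eq0 addrC -LD// subrr L0.
exists (fun g j => L (point_edge g j)); split=> [g j|g].
  have Wp := finitely_supported_point g j.
  have pU : vanish_off [fset g] (point_edge g j).
    by move=> u i; rewrite inE /point_edge => /negbTE ->.
  have npU : vanish_off [fset g] (- point_edge g j).
    by move=> u i /(pU u i); rewrite !fctE => ->; rewrite oppr0.
  apply/andP; split.
    rewrite -oppr_le0 -LN//; apply: le_trans (Lp _ _) _; first by exists [fset g].
    rewrite (positive_partE npU) big_seq_fset1 big1// => i _.
    by rewrite !fctE max_l// oppr_le0.
  apply: le_trans (Lp _ Wp) _; rewrite (positive_partE pU) big_seq_fset1.
  rewrite (bigD1 j)//= /point_edge !eqxx max_r// big1 ?addr0// => i /negbTE ->.
  by rewrite maxxx.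
have Lsum (s : seq 'I_n) (w : 'I_n -> V) : (forall j, finitely_supported (w j)) ->
    finitely_supported (\sum_(j <- s) w j) /\ L (\sum_(j <- s) w j) = \sum_(j <- s) L (w j).
  move=> Ww; elim: s => [|j s [Ws Ls]]; first by rewrite !big_nil.
  by rewrite !big_cons; split; [exact: WD|rewrite LD// Ls].
pose f (u : K) : R := (u == g)%:R.
have -> : \sum_(j < n) (L (point_edge g j) - L (point_edge (g * (x j)^-1)%g j)) =
    L (outflow f).
  have -> : outflow f = \sum_(j < n) (point_edge g j - point_edge (g * (x j)^-1)%g j).
    apply/funext => u; apply/funext => i; rewrite !fct_sumE (bigD1 i)//=.
    rewrite big1 => [|j ji].
      rewrite addr0 !fctE /outflow /f /point_edge eqxx !andbT; congr (_ - _%:R).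
      by rewrite -(inj_eq (mulIg (x i)^-1%g)) mulgK.
    by rewrite !fctE /point_edge [i == j]eq_sym (negbTE ji) !andbF subrr.
  rewrite (Lsum _ _ _).2; last first.
    move=> j; apply: WD; first exact: finitely_supported_point.
    by rewrite -scaleN1r; apply: WZ; exact: finitely_supported_point.
  apply: eq_bigr => j _; rewrite LD ?LN//; try exact: finitely_supported_point.
  by rewrite -scaleN1r; apply: WZ; exact: finitely_supported_point.
apply: LA; exists [fset g], f; split=> //=.
- by move=> u; rewrite inE /f => /negbTE ->.
- by rewrite big_seq_fset1 /f eqxx mulr1.
Qed.

End Flow.

(** * Means from finitely additive measures *)
Section Mean.
Variables (R : realType) (H : Type) (mu : set H -> R).
Local Open Scope classical_set_scope.
Local Open Scope ring_scope.
Hypotheses (mu0 : forall A, 0 <= mu A) (muT : mu setT = 1)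
  (muU : forall A B, A `&` B = set0 -> mu (A `|` B) = mu A + mu B).

Lemma mu_set0 : mu set0 = 0.
Proof. by have := muU (setI0 set0); rewrite setU0; lra. Qed.

Lemma mu_setIC A B : mu B = mu (A `&` B) + mu (~` A `&` B).
Proof.
rewrite -muU; first by rewrite -setIUl setUv setTI.
by rewrite setIACA setICr set0I.
Qed.

Lemma mu_le1 A : mu A <= 1.
Proof. by rewrite -muT (mu_setIC A setT) !setIT lerDl. Qed.

(** A simple function that is at least a on B has integral at least a * mu B over B:
    by induction on the number of sets, splitting B along the first of them. *)
Lemma simple_integral_ge (I : Type) (r : seq I) (c : I -> R) (A : I -> set H) a B :
  (forall h, B h -> a <= \sum_(i <- r) c i * (h \in A i)%:R) ->
  a * mu B <= \sum_(i <- r) c i * mu (A i `&` B).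
Proof.
elim: r a B => [|i r IHr] a B aB.
  rewrite big_nil; have [[h /aB]|/nonemptyPn ->] := pselect (B !=set0).
    by rewrite big_nil => a0; rewrite mulr_le0_ge0.
  by rewrite mu_set0 mulr0.
have splitB : \sum_(k <- r) c k * mu (A k `&` B) =
    \sum_(k <- r) c k * mu (A k `&` (A i `&` B)) +
    \sum_(k <- r) c k * mu (A k `&` (~` A i `&` B)).
  rewrite -big_split; apply: eq_bigr => k _ /=.
  by rewrite -mulrDr (mu_setIC (A i) (A k `&` B)) !(setICA (A k)).
rewrite big_cons splitB.
have H1 : (a - c i) * mu (A i `&` B) <= \sum_(k <- r) c k * mu (A k `&` (A i `&` B)).
  apply: IHr => h [Ah Bh]; have := aB _ Bh; rewrite big_cons.
  by rewrite (mem_set Ah) mulr1 lerBlDl.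
have H2 : a * mu (~` A i `&` B) <= \sum_(k <- r) c k * mu (A k `&` (~` A i `&` B)).
  apply: IHr => h [Ah Bh]; have := aB _ Bh; rewrite big_cons.
  by rewrite memNset// mulr0 add0r.
have := mu_setIC (A i) B => ->.
by move: H1 H2; rewrite mulrBl mulrDr; lra.
Qed.

Variable k : nat.
Hypothesis k0 : (0 < k)%N.

(** For f with values in [0, 1], the sets on which k * f is at least t + 1. *)
Definition level (f : H -> R) (t : nat) : set H := [set h | t.+1%:R <= k%:R * f h].

(** The mean of f rounded down to a multiple of 1/k. It involves only the measures
    of finitely many sets, so it inherits the invariance of mu, and the rounding
    error is at most 1/k. *)
Definition mean (f : H -> R) : R := k%:R^-1 * \sum_(t < k) mu (level f t).

Let kp : 0 < k%:R :> R. Proof. by rewrite ltr0n. Qed.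

Lemma mean_ge0 f : 0 <= mean f.
Proof. by rewrite mulr_ge0 ?invr_ge0// sumr_ge0. Qed.

Lemma mean_le1 f : mean f <= 1.
Proof.
rewrite /mean ler_pdivrMl// mulr1.
apply: (@le_trans _ _ (\sum_(t < k) 1)); first by apply: ler_sum => t _; exact: mu_le1.
by rewrite sumr_const card_ord.
Qed.

Lemma count_below_le m (s : R) : 0 <= s -> \sum_(t < m) (t.+1%:R <= s)%R%:R <= s.
Proof.
move=> s0; elim: m => [|m IHm]; first by rewrite big_ord0.
rewrite big_ord_recr /=; have [ms|ms] := boolP (m.+1%:R <= s); last by rewrite addr0.
apply: le_trans ms; rewrite -natr1 lerD2r.
apply: (@le_trans _ _ (\sum_(t < m) 1)).
  by apply: ler_sum => t _; case: (t.+1%:R <= s)%R; rewrite ?lexx ?ler01.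
by rewrite sumr_const card_ord.
Qed.

Lemma count_below_ge m (s : R) : s <= m%:R -> s - 1 <= \sum_(t < m) (t.+1%:R <= s)%R%:R.
Proof.
elim: m => [|m IHm] sm; first by rewrite big_ord0; lra.
rewrite big_ord_recr /=; have [/IHm|ms] := leP s m%:R.
  by move/le_trans; apply; rewrite lerDl.
have -> : \sum_(t < m) (t.+1%:R <= s)%R%:R = m%:R :> R.
  rewrite (eq_bigr (fun=> 1)) => [|t _]; first by rewrite sumr_const card_ord.
  by rewrite (le_trans _ (ltW ms))// ler_nat.
by move: sm; rewrite -natr1 => sm; apply: ler_wpDr => //; lra.
Qed.

Lemma discretization f h : 0 <= f h <= 1 ->
  f h - k%:R^-1 <= k%:R^-1 * \sum_(t < k) (h \in level f t)%:R <= f h.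
Proof.
move=> /andP[f0 f1].
have -> : \sum_(t < k) (h \in level f t)%:R = \sum_(t < k) (t.+1%:R <= k%:R * f h)%R%:R :> R.
  by apply: eq_bigr => t _; congr (nat_of_bool _)%:R; apply/idP/idP; rewrite inE.
have kf0 : 0 <= k%:R * f h by rewrite mulr_ge0.
have kfk : k%:R * f h <= k%:R by rewrite ler_piMr.
apply/andP; split; last by rewrite ler_pdivrMl//; exact: count_below_le.
have -> : f h - k%:R^-1 = k%:R^-1 * (k%:R * f h - 1).
  by rewrite mulrBr mulrA mulVf ?gt_eqF// mul1r mulr1.
by rewrite ler_wpM2l ?invr_ge0//; exact: count_below_ge.
Qed.

(** The mean does not have to be additive: a pointwise inequality between sums
    persists up to the rounding errors. *)
Lemma mean_sum_ge n (f g : 'I_n -> H -> R) (a : R) :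
  (forall j h, 0 <= f j h <= 1) -> (forall j h, 0 <= g j h <= 1) ->
  (forall h, a <= \sum_(j < n) (f j h - g j h)) ->
  a - n%:R / k%:R <= \sum_(j < n) (mean (f j) - mean (g j)).
Proof.
move=> f01 g01 afg.
pose c (i : bool * ('I_n * 'I_k)) : R := if i.1 then k%:R^-1 else - k%:R^-1.
pose A (i : bool * ('I_n * 'I_k)) := level ((if i.1 then f else g) i.2.1) i.2.2.
have sumE (F : bool * ('I_n * 'I_k) -> R) : \sum_i c i * F i =
    \sum_(j < n) (k%:R^-1 * \sum_(t < k) F (true, (j, t)) -
                  k%:R^-1 * \sum_(t < k) F (false, (j, t))).
  have pairE (I J : finType) (E : I * J -> R) : \sum_i E i = \sum_i \sum_j E (i, j).
    by rewrite pair_bigA; apply: eq_bigr => -[].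
  rewrite pairE big_bool /= !pairE.
  rewrite -big_split; apply: eq_bigr => j _ /=.
  by rewrite -!mulr_sumr mulNr.
have /simple_integral_ge : forall h, setT h ->
    a - n%:R / k%:R <= \sum_(i <- index_enum _) c i * (h \in A i)%:R.
  move=> h _; rewrite sumE /A /=; apply: le_trans (lerB (afg h) (lexx _)) _.
  rewrite lerBlDr.
  have -> : n%:R / k%:R = \sum_(j < n) k%:R^-1 :> R by rewrite sumr_const card_ord mulr_natl.
  rewrite -big_split; apply: ler_sum => j _ /=.
  have /andP[fl _] := discretization (f01 j h); have /andP[_ gu] := discretization (g01 j h).
  lra.
rewrite muT mulr1 => /le_trans; apply.
rewrite (sumE (fun i => mu (A i `&` setT))); apply: ler_sum => j _.
rewrite /mean /A /=; under eq_bigr do rewrite setIT.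
by under [X in _ - _ * X <= _]eq_bigr do rewrite setIT.
Qed.

End Mean.

Lemma sum_fset_widen (R : realType) (T : choiceType) (U S : {fset T}) (F : T -> R) :
  (S `<=` U)%fset ->
  (\sum_(q <- S) F q = \sum_(q <- U) (q \in S)%:R * F q)%R.
Proof.
move=> SU; rewrite -(big_fset_incl _ SU)/= => [|q _ /negbTE ->]; last by rewrite mul0r.
by rewrite big_seq [RHS]big_seq; apply: eq_bigr => q ->; rewrite mul1r.
Qed.

(** * Quotients by amenable subgroups *)
Section AmenableQuotient.
Variables (R : realType) (n : nat) (G : groupType) (P : presentation n G).
Variables (N : groupClosed G) (nN : is_normal N).
Local Open Scope ring_scope.

Local Notation H := (subgroup_of N).
Local Notation Q := (quotient_group nN).
Local Notation x := (gens P).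
Local Notation y := (gens (induced_presentation P nN)).

Lemma quotient_proj_gens g j : quotient_proj nN (g * x j)%g = (quotient_proj nN g * y j)%g.
Proof. by rewrite -quotient_projM. Qed.

Lemma quotient_proj_gensV g j :
  quotient_proj nN (g * (x j)^-1)%g = (quotient_proj nN g * (y j)^-1)%g.
Proof.
by apply: (mulIg (y j)); rewrite -quotient_proj_gens !mulgVK.
Qed.

Lemma same_coset (u v : G) : quotient_proj nN u = quotient_proj nN v ->
  exists k : H, u = (val k * v)%g.
Proof.
move/eqP; rewrite eq_sym quotient_proj_eq => vuN.
have := nN v^-1%g vuN; rewrite conjgE invgK => uvN.
by exists (exist (fun g : G => g \in N) _ uvN); rewrite /= !mulgA mulgV mul1g mulgVK.
Qed.

(** The definition of amenability provides a left-invariant measure; inversion makes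
    it right-invariant. *)
Lemma right_invariant_mean : amenable R H -> exists mu : set H -> R,
  [/\ forall A, 0 <= mu A, mu [set: H]%classic = 1,
      forall A B, (A `&` B = set0)%classic -> mu (A `|` B)%classic = mu A + mu B &
      forall (k : H) A, mu [set h | A (h * k)%g]%classic = mu A].
Proof.
move=> [mu [mu0 muT muU muM]].
exists (fun A => mu [set (h^-1)%g | h in A]%classic); split.
- by move=> A.
- rewrite -muT; congr mu; apply/seteqP; split=> // h _.
  by exists (h^-1)%g => //; rewrite invgK.
- move=> A B AB; rewrite image_setU muU//; apply/seteqP; split=> //.
  move=> _ [[h Ah <-] [h' Bh' /invg_inj E]].
  by have : (A `&` B)%classic h by [split; rewrite // -E]; rewrite AB.
- move=> k A; rewrite -(muM k [set (h^-1)%g | h in A]%classic); congr mu.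
  apply/seteqP; split=> [_ [h Ah <-]|_ [_ [h Ah <-] <-]] /=.
    by exists (h * k)^-1%g; [exists (h * k)%g|rewrite invgM mulgA mulgV mul1g].
  exists (h * k^-1)%g; rewrite /= ?mulgVK// invgM invgK//.
Qed.

(** The average psi of the flow phi over the coset q of N does not depend on the
    representative g of q: it is the mean of phi (h g) over h in N, and another
    representative has the form u g with u in N, which amounts to the right
    translation of h by u. *)
Lemma isoperimetric_amenable : amenable R H -> isoperimetric R x <= isoperimetric R y.
Proof.
move=> /right_invariant_mean[mu [mu0 muT muU muM]].
have [phi [phi01 phi_flow]] := isoperimetric_flow (@isoperimetric_le R _ _ x).
set a := isoperimetric R x in phi_flow *.
apply: isoperimetric_glb => T T0.
pose psi k (q : Q) j : R := mean mu k (fun h : H => phi (val h * repr q)%g j).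
have psi_shift k g j :
    mean mu k (fun h : H => phi (val h * g)%g j) = psi k (quotient_proj nN g) j.
  have [u gE] := same_coset (esym (quotient_projP (quotient_proj nN g))).
  rewrite /psi /mean; congr (_ * _); apply: eq_bigr => t _.
  rewrite -[in RHS](muM u); congr mu; apply/seteqP; split=> h; rewrite /level /=.
    by rewrite (_ : val (h * u)%g * _ = val h * g)%g// [in RHS]gE mulgA.
  by rewrite (_ : val (h * u)%g * _ = val h * g)%g// [in RHS]gE mulgA.
have psi_flow k (q : Q) : (0 < k)%N ->
    a - n%:R / k%:R <= \sum_(j < n) (psi k q j - psi k (q * (y j)^-1)%g j).
  move=> k0; have -> : \sum_(j < n) (psi k q j - psi k (q * (y j)^-1)%g j) =
      \sum_(j < n) (mean mu k (fun h : H => phi (val h * repr q)%g j) -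
                    mean mu k (fun h : H => phi (val h * repr q * (x j)^-1)%g j)).
    apply: eq_bigr => j _; congr (_ - _).
    rewrite -{1}(quotient_projP q) -quotient_proj_gensV -psi_shift.
    by congr mean; apply/funext => h; rewrite mulgA.
  by apply: mean_sum_ge => //.
have sum_psi k : (0 < k)%N -> (a - n%:R / k%:R) * #|` T|%:R <= (boundary y T)%:R.
  move=> k0.
  have : \sum_(q <- T) (a - n%:R / k%:R) <=
      \sum_(q <- T) \sum_(j < n) (psi k q j - psi k (q * (y j)^-1)%g j).
    by apply: ler_sum => q _; exact: psi_flow.
  rewrite big_const_seq count_predT iter_addr_0 -[X in X <= _ -> _]mulr_natr.
  move/le_trans; apply.
  rewrite exchange_big /boundary natr_sum; apply: ler_sum => j _.
  (* the flow along the edges labelled j within T cancels in the sum over T *)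
  have psi01 q : 0 <= psi k q j <= 1 by rewrite mean_ge0// mean_le1.
  pose T' := [fset (q * (y j)^-1)%g | q in T]%fset.
  have T'E q : (q \in T') = ((q * y j)%g \in T).
    apply/imfsetP/idP => [[u /= uT ->]|qT]; first by rewrite mulgVK.
    by exists (q * y j)%g => //; rewrite mulgK.
  pose U := (T `|` T')%fset.
  have sT' : \sum_(q <- T) psi k (q * (y j)^-1)%g j = \sum_(q <- T') psi k q j.
    by rewrite big_imfset//= => u v _ _; exact: mulIg.
  have -> : \sum_(q <- T) (psi k q j - psi k (q * (y j)^-1)%g j) =
      \sum_(q <- U) ((q \in T)%:R * psi k q j - (q \in T')%:R * psi k q j).
    by rewrite !sumrB sT' -!sum_fset_widen ?fsubsetUl ?fsubsetUr.
  rewrite natr_sum [leRHS](@sum_fset_widen _ _ U) ?fsubsetUl//.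
  apply: ler_sum => q _; rewrite -T'E; have := psi01 q.
  by case: (q \in T); case: (q \in T') => /= /andP[p0 p1]; lra.
(* k is chosen so large that the rounding errors n/k do not matter *)
rewrite leNgt; apply/negP => aT.
have c0 := @natr_card_gt0 R _ _ T0.
pose e := a * #|` T|%:R - (boundary y T)%:R.
have e0 : 0 < e by rewrite subr_gt0.
pose k := (Num.truncn (n%:R * #|` T|%:R / e)).+1.
have kp : 0 < k%:R :> R by rewrite ltr0n.
have := sum_psi k isT; rewrite mulrBl.
have : n%:R / k%:R * #|` T|%:R < e; last by rewrite /e; lra.
rewrite mulrAC ltr_pdivrMr// [e * _]mulrC -ltr_pdivrMr//; exact: truncnS_gt.
Qed.

End AmenableQuotient.

(** * The inequality for normal subgroups *)
Local Open Scope ereal_scope.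

Theorem theorem3p1 (R : realType) (n : nat) (G : groupType)
    (P : presentation n G) (N : groupClosed G) (nN : is_normal N) :
  let G2 : groupType := quotient_group nN in
  let P2 : presentation n G2 := induced_presentation P nN in
  normalized_cyclomatic_quotient R P <=
    normalized_cyclomatic_quotient R P2 - (inv_card R G2 - inv_card R G)%:E /\
  (amenable R (subgroup_of N) ->
    normalized_cyclomatic_quotient R P =
      normalized_cyclomatic_quotient R P2
        - (inv_card R G2 - inv_card R G)%:E).
Proof.
move=> G2 P2; rewrite !normalized_cyclomatic_quotientE -EFinB.
have le21 : (isoperimetric R (gens P2) <= isoperimetric R (gens P))%R.
  exact: (isoperimetric_projection R (quotient_proj_gens P nN)).
split=> [|amN]; first by rewrite lee_fin; lra.
have le12 : (isoperimetric R (gens P) <= isoperimetric R (gens P2))%R.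
  exact: isoperimetric_amenable.
congr (_%:E); lra.
Qed.
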